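(* Let $d\ge 1$, $\boldsymbol{\nu}\in\mathbb{N}_0^d$ and $[a,b]\subset\mathbb{R}$. Suppose that $\phi$ and $\rho_0$ are $\boldsymbol{\nu}$-admissible, and that for $q=0$ and every $\boldsymbol{\eta}\in\mathbb{N}_0^d$ with $\boldsymbol{0}\neq\boldsymbol{\eta}\le\boldsymbol{\nu}$ the $(q,\boldsymbol{\eta})$-decay condition holds on $[a,b]$ with constant $B_{0,\boldsymbol{\eta}}$. For $t\in[a,b]$ define $g_t(y_0,\boldsymbol{y}) := \mathrm{ind}(t-\phi(y_0,\boldsymbol{y}))$, where $\mathrm{ind}(z)=1$ if $z\ge 0$ and $\mathrm{ind}(z)=0$ otherwise, and $$P_0g_t(\boldsymbol{y}) := \int_{-\infty}^\infty g_t(y_0,\boldsymbol{y})\,\rho_0(y_0)\,\mathrm{d}y_0,\qquad \boldsymbol{y}\in\mathbb{R}^d .$$ Then for every $t\in[a,b]$, $P_0 g_t\in\mathcal{H}^{\boldsymbol{\nu}}_d\cap C^{\boldsymbol{\nu}}(\mathbb{R}^d)$, and $$\sup_{t\in[a,b]}\|P_0g_t\|_{\mathcal{H}^{\boldsymbol{\nu}}_d}\le\Bigg(1+\sum_{\boldsymbol{0}\ne\boldsymbol{\eta}\le\boldsymbol{\nu}}\frac{\big(8^{|\boldsymbol{\eta}|-1}(|\boldsymbol{\eta}|-1)!\big)^2B_{0,\boldsymbol{\eta}}}{\gamma_{\boldsymbol{\eta}}}\Bigg)^{1/2}<\infty .$$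
   Context: Notation. $\mathbb{N}_0=\{0,1,2,\dots\}$. For multi-indices, $|\boldsymbol{\nu}|$ is the sum of the components, $\mathrm{supp}(\boldsymbol{\nu})$ the set of indices of nonzero components, $\le$ and $+$ are componentwise, and $\boldsymbol{e}_i$ is the multi-index with $i$th component 1 and all others 0. Points of $\mathbb{R}^{d+1}$ are written $(y_0,\boldsymbol{y})$ with $\boldsymbol{y}=(y_1,\dots,y_d)\in\mathbb{R}^d$ (coordinates indexed $0,\dots,d$; those of $\mathbb{R}^d$ indexed $1,\dots,d$); multi-indices in $\mathbb{N}_0^{d+1}$ are written $(\nu_0,\boldsymbol{\nu})$ correspondingly. $D^i=\partial/\partial y_i$ and $D^{\boldsymbol{\eta}}=\prod_i\partial^{\eta_i}/\partial y_i^{\eta_i}$ (also used for weak derivatives). $C^{\boldsymbol{\nu}}$ is the space of continuous functions $g$ such that $D^{\boldsymbol{\eta}}g$ is continuous for all $\boldsymbol{\eta}\le\boldsymbol{\nu}$. Densities and weights. For $i=0,\dots,d$, $\rho_i$ is a probability density on $\mathbb{R}$ with support $\mathbb{R}$ and cdf $\Phi_i$. The $\psi_i:\mathbb{R}\to\mathbb{R}$, $i=0,\dots,d$, are strictly positive integrable functions, and it is assumed throughout that $\int_{-\infty}^\infty \frac{\Phi_i(z)(1-\Phi_i(z))}{\psi_i(z)}\,\mathrm{d}z<\infty$ for $i=1,\dots,d$. Weight parameters: $\gamma_{\mathfrak{u}}>0$ for $\mathfrak{u}\subseteq\{0,\dots,d\}$, $\gamma_\emptyset=1$, and $\gamma_{\boldsymbol{\eta}}:=\gamma_{\mathrm{supp}(\boldsymbol{\eta})}$.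 Write $\boldsymbol{\psi}_{\boldsymbol{\eta}}(\boldsymbol{y}_{\boldsymbol{\eta}})=\prod_{i:\eta_i\neq0}\psi_i(y_i)$ and $\boldsymbol{\rho}_{-\boldsymbol{\eta}}(\boldsymbol{y}_{-\boldsymbol{\eta}})=\prod_{i:\eta_i=0}\rho_i(y_i)$. Spaces. For $\boldsymbol{\nu}\in\mathbb{N}_0^d$, $\mathcal{H}^{\boldsymbol{\nu}}_d$ is the space of locally integrable functions $g$ on $\mathbb{R}^d$ (with weak derivatives $D^{\boldsymbol{\eta}}g$, $\boldsymbol{\eta}\le\boldsymbol{\nu}$) whose norm $$\|g\|^2_{\mathcal{H}^{\boldsymbol{\nu}}_d}=\sum_{\boldsymbol{\eta}\le\boldsymbol{\nu}}\frac1{\gamma_{\boldsymbol{\eta}}}\int_{\mathbb{R}^d}|D^{\boldsymbol{\eta}}g(\boldsymbol{y})|^2\,\boldsymbol{\psi}_{\boldsymbol{\eta}}(\boldsymbol{y}_{\boldsymbol{\eta}})\,\boldsymbol{\rho}_{-\boldsymbol{\eta}}(\boldsymbol{y}_{-\boldsymbol{\eta}})\,\mathrm{d}\boldsymbol{y}$$ is finite (indices $1,\dots,d$). $\mathcal{H}^{(\nu_0,\boldsymbol{\nu})}_{d+1}$ is defined in the same way on $\mathbb{R}^{d+1}$ with indices $0,\dots,d$. $\boldsymbol{\nu}$-admissibility. $\phi:\mathbb{R}^{d+1}\to\mathbb{R}$ and $\rho_0$ are called $\boldsymbol{\nu}$-admissible if: (1) $D^0\phi(y_0,\boldsymbol{y})>0$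 for all $(y_0,\boldsymbol{y})\in\mathbb{R}^{d+1}$; (2) for each $\boldsymbol{y}\in\mathbb{R}^d$, $\phi(y_0,\boldsymbol{y})\to\infty$ as $y_0\to\infty$; (3) $\phi\in\mathcal{H}^{(\nu_0,\boldsymbol{\nu})}_{d+1}\cap C^{(\nu_0,\boldsymbol{\nu})}(\mathbb{R}^{d+1})$ with $\nu_0:=|\boldsymbol{\nu}|+1$; (4) $\rho_0\in C^{|\boldsymbol{\nu}|}(\mathbb{R})$. Discontinuity point. For $t\in[a,b]$, $U_t:=\{\boldsymbol{y}\in\mathbb{R}^d:\phi(y_0,\boldsymbol{y})=t\text{ for some }y_0\in\mathbb{R}\}$, and for $\boldsymbol{y}\in U_t$, $\xi(t,\boldsymbol{y})$ is the unique real number with $\phi(\xi(t,\boldsymbol{y}),\boldsymbol{y})=t$. $(q,\boldsymbol{\eta})$-decay condition. Let $q\in\mathbb{N}_0$ and $\boldsymbol{\eta}\le\boldsymbol{\nu}$ with $|\boldsymbol{\eta}|+q\le|\boldsymbol{\nu}|+1$. A function of type $(q,\boldsymbol{\eta})$ is a function, defined for $t\in[a,b]$ and $\boldsymbol{y}\in U_t$, of the form $$h_{q,\boldsymbol{\eta}}(t,\boldsymbol{y})=\frac{(-1)^r\rho_0^{(\beta)}(\xi(t,\boldsymbol{y}))\prod_{\ell=1}^rD^{\boldsymbol{\alpha}_\ell}\phi(\xi(t,\boldsymbol{y}),\boldsymbol{y})}{[D^0\phi(\xi(t,\boldsymbol{y}),\boldsymbol{y})]^{r+q}},$$ where $r\in\mathbb{N}_0$,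 $\boldsymbol{\alpha}_\ell\in\mathbb{N}_0^{d+1}\setminus\{\boldsymbol{e}_0,\boldsymbol{0}\}$ for $\ell=1,\dots,r$, $\beta\in\mathbb{N}_0$ satisfy $r\le2|\boldsymbol{\eta}|+q-1$, $\alpha_{\ell,0}\le|\boldsymbol{\eta}|+q$, $\beta\le|\boldsymbol{\eta}|+q-1$ and $\beta\boldsymbol{e}_0+\sum_{\ell=1}^r\boldsymbol{\alpha}_\ell=(r+q-1,\boldsymbol{\eta})$. The $(q,\boldsymbol{\eta})$-decay condition holds on $[a,b]$ with constant $B_{q,\boldsymbol{\eta}}<\infty$ if every function $h_{q,\boldsymbol{\eta}}$ of type $(q,\boldsymbol{\eta})$ satisfies: for all $t\in[a,b]$, $h_{q,\boldsymbol{\eta}}(t,\boldsymbol{y})\to0$ as $\boldsymbol{y}\to\partial U_t$ (i.e. as $\boldsymbol{y}\in U_t$ tends to any point of the boundary $\partial U_t$), and $$\sup_{t\in[a,b]}\int_{U_t}|h_{q,\boldsymbol{\eta}}(t,\boldsymbol{y})|^2\,\boldsymbol{\psi}_{\boldsymbol{\eta}}(\boldsymbol{y}_{\boldsymbol{\eta}})\,\boldsymbol{\rho}_{-\boldsymbol{\eta}}(\boldsymbol{y}_{-\boldsymbol{\eta}})\,\mathrm{d}\boldsymbol{y}\le B_{q,\boldsymbol{\eta}}.$$ *)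

(* Defs.v *)
From HB Require Import structures.
From mathcomp Require Import all_boot all_order all_algebra.
From mathcomp Require Import all_classical all_reals all_analysis.

Set Implicit Arguments.
Unset Strict Implicit.
Unset Printing Implicit Defensive.

Import Order.TTheory GRing.Theory Num.Theory.
Import numFieldNormedType.Exports.

Local Open Scope classical_set_scope.
Local Open Scope ring_scope.

(* Points (y_0, y) of R^(n+1): y_0 is the coordinate of index ord0, and the
   coordinates of y are those of index lift ord0 i. *)

Section Points.
Context {T : Type} {n : nat}.

Definition pcons (y0 : T) (y : 'rV[T]_n) : 'rV[T]_n.+1 :=
  \row_i oapp (fun j => y ord0 j) y0 (unlift ord0 i).

Definition pbehead (x : 'rV[T]_n.+1) : 'rV[T]_n :=
  \row_i x ord0 (lift ord0 i).

Lemma pcons0 y0 (y : 'rV[T]_n) : pcons y0 y ord0 ord0 = y0.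
Proof. by rewrite mxE unlift_none. Qed.

Lemma pconsS y0 (y : 'rV[T]_n) i : pcons y0 y ord0 (lift ord0 i) = y ord0 i.
Proof. by rewrite mxE liftK. Qed.

Lemma pcons_behead (x : 'rV[T]_n.+1) : pcons (x ord0 ord0) (pbehead x) = x.
Proof.
apply/rowP => i; rewrite mxE; case: unliftP => [j ->|->] //=.
by rewrite mxE.
Qed.

Lemma pbeheadK y0 (y : 'rV[T]_n) : pbehead (pcons y0 y) = y.
Proof. by apply/rowP => i; rewrite mxE pconsS. Qed.

End Points.

(* The product (equivalently, Borel) sigma-algebra on R^n. *)

Section MeasurableRow.
Context {R : realType} {n : nat}.

Definition coord (i : 'I_n) (x : 'rV[R]_n) : R := x ord0 i.

Let row_set0 : g_sigma_preimage coord set0.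
Proof. exact: sigma_algebra0. Qed.

Let row_setC A : g_sigma_preimage coord A -> g_sigma_preimage coord (~` A).
Proof. exact: sigma_algebraC. Qed.

Let row_bigcup (F : (set 'rV[R]_n)^nat) :
  (forall i, g_sigma_preimage coord (F i)) ->
  g_sigma_preimage coord (\bigcup_i (F i)).
Proof. exact: sigma_algebra_bigcup. Qed.

HB.instance Definition _ :=
  @isMeasurable.Build (measure_tuple_display default_measure_display)
    'rV[R]_n (g_sigma_preimage coord) row_set0 row_setC row_bigcup.

Lemma measurable_coord (i : 'I_n) : measurable_fun [set: 'rV[R]_n] (coord i).
Proof.
move=> _ Y mY; rewrite setTI; apply: sub_sigma_algebra => /=.
rewrite -bigcup_seq/=; exists i => /=; first by rewrite mem_index_enum.
by exists Y => //; rewrite setTI.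
Qed.

Lemma measurable_fun_coordP d (T : measurableType d) (f : T -> 'rV[R]_n) :
  (forall i, measurable_fun [set: T] (coord i \o f)) ->
  measurable_fun [set: T] f.
Proof.
move=> mf.
have prefS : g_sigma_preimage (fun i => coord i \o f) `<=` measurable.
  apply: smallest_sub; first exact: sigma_algebra_measurable.
  rewrite -bigcup_seq/=; apply: bigcup_sub => i _ A [B mB <-].
  exact: mf.
move: prefS; rewrite g_sigma_preimage_comp => prefS _ A mA.
by apply: prefS; exists A.
Qed.

End MeasurableRow.

Section MeasurableCons.
Context {R : realType} {n : nat}.

Definition pcons2 (p : measurableTypeR R * 'rV[R]_n) : 'rV[R]_n.+1 := pcons p.1 p.2.

Lemma measurable_pcons2 : measurable_fun setT pcons2.
Proof.
apply: measurable_fun_coordP => i.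
have [j ->|->] := unliftP ord0 i.
  have -> : coord (lift ord0 j) \o pcons2 = coord j \o snd.
    by apply/funext => p /=; rewrite /coord /pcons2 pconsS.
  by apply: measurableT_comp => //; exact: measurable_coord.
have -> : coord ord0 \o pcons2 = fst.
  by apply/funext => p /=; rewrite /coord /pcons2 pcons0.
exact: measurable_fst.
Qed.

Lemma measurable_pbehead :
  measurable_fun setT (pbehead : 'rV[R]_n.+1 -> 'rV[R]_n).
Proof.
apply: measurable_fun_coordP => i.
have -> : coord i \o pbehead = coord (lift ord0 i) :> ('rV[R]_n.+1 -> R).
  by apply/funext => x /=; rewrite /coord mxE.
exact: measurable_coord.
Qed.

Section step.
Local Open Scope ereal_scope.
Variable m : {sigma_finite_measure set 'rV[R]_n -> \bar R}.

Let lambda1 : {sigma_finite_measure set (measurableTypeR R) -> \bar R} :=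
  @lebesgue_measure R.

Definition lebesgue_step : set 'rV[R]_n.+1 -> \bar R :=
  pushforward (lambda1 \x m) pcons2.

Let lebesgue_step0 : lebesgue_step set0 = 0.
Proof. by rewrite /lebesgue_step /pushforward preimage_set0 measure0. Qed.

Let lebesgue_step_ge0 A : 0 <= lebesgue_step A.
Proof. by rewrite /lebesgue_step /pushforward; exact: measure_ge0. Qed.

Let lebesgue_step_sigma_additive : semi_sigma_additive lebesgue_step.
Proof.
move=> F mF tF mUF; rewrite /lebesgue_step /pushforward preimage_bigcup.
apply: measure_semi_sigma_additive.
- by move=> k; rewrite -[X in measurable X]setTI; exact: measurable_pcons2.
- apply/trivIsetP => /= i j _ _ ij; rewrite -preimage_setI.
  by move/trivIsetP : tF => /(_ _ _ _ _ ij) ->//; rewrite preimage_set0.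
- rewrite -preimage_bigcup -[X in measurable X]setTI.
  exact: measurable_pcons2.
Qed.

HB.instance Definition _ := isMeasure.Build _ _ _ lebesgue_step
  lebesgue_step0 lebesgue_step_ge0 lebesgue_step_sigma_additive.

Let lebesgue_step_sigma_finite : sigma_finite setT lebesgue_step.
Proof.
have /sigma_finiteP[F [TF ndF Foo]] := sigma_finiteT lambda1.
have /sigma_finiteP[G [TG ndG Goo]] := sigma_finiteT m.
exists (fun k => coord ord0 @^-1` F k `&` pbehead @^-1` G k).
  rewrite predeqE => x; split=> // _.
  have [k _ Fk] : (\bigcup_k F k) (x ord0 ord0) by rewrite -TF.
  have [l _ Gl] : (\bigcup_k G k) (pbehead x) by rewrite -TG.
  exists (maxn k l) => //; split.
    by have /subsetPset := ndF _ _ (leq_maxl k l); exact.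
  by have /subsetPset := ndG _ _ (leq_maxr k l); exact.
move=> k; have [mF Fk] := Foo k; have [mG Gk] := Goo k; split.
  apply: measurableI; rewrite -[X in measurable X]setTI.
    exact: (@measurable_coord R n.+1 ord0).
  exact: measurable_pbehead.
rewrite /lebesgue_step /pushforward.
rewrite (_ : pcons2 @^-1` _ = F k `*` G k).
  by rewrite product_measure1E// lte_mul_pinfty// ge0_fin_numE.
apply/seteqP; split => -[y0 y] /=;
  by rewrite /coord /pcons2 pcons0 pbeheadK.
Qed.

HB.instance Definition _ :=
  Measure_isSigmaFinite.Build _ _ _ lebesgue_step lebesgue_step_sigma_finite.

End step.
End MeasurableCons.

(* Lebesgue measure on R^n, by iterated products. *)
Fixpoint lebesgue_rV (R : realType) (n : nat) :
    {sigma_finite_measure set 'rV[R]_n -> \bar R} :=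
  match n with
  | 0 => \d_(0 : 'rV[R]_0)
  | n'.+1 => lebesgue_step (lebesgue_rV R n')
  end.

Lemma lebesgue_rV_box (R : realType) (n : nat) (A : 'I_n -> set R) :
  (forall i, measurable (A i)) ->
  lebesgue_rV R n [set x | forall i, A i (x ord0 i)] =
  (\prod_(i < n) @lebesgue_measure R (A i))%E.
Proof.
elim: n A => [|n IHn] A mA.
  rewrite big_ord0 /= diracE mem_set//.
  by case.
rewrite big_ord_recl -(IHn (fun i => A (lift ord0 i)))//.
rewrite /= /lebesgue_step /pushforward.
have mB : measurable [set x : 'rV[R]_n | forall i, A (lift ord0 i) (x ord0 i)].
  rewrite (_ : mkset _ = \big[setI/setT]_(i < n) (coord i @^-1` A (lift ord0 i))).
    apply: bigsetI_measurable => i _.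
    by rewrite -[X in measurable X]setTI; exact: measurable_coord.
  rewrite -bigcap_seq; apply/seteqP; split => x /= Ax i; first by move=> _; exact: Ax.
  by apply: Ax => /=; rewrite mem_index_enum.
rewrite (_ : pcons2 @^-1` _ = A ord0 `*`
    [set x : 'rV[R]_n | forall i, A (lift ord0 i) (x ord0 i)]).
  exact: (product_measure1E (@lebesgue_measure R) (lebesgue_rV R n) (mA ord0) mB).
apply/seteqP; split => -[y0 y] /=.
  move=> Ax; split => [|i]; first by have := Ax ord0; rewrite /pcons2 pcons0.
  by have := Ax (lift ord0 i); rewrite /pcons2 pconsS.
case=> A0 AS i; rewrite /pcons2.
by have [j ->|->] := unliftP ord0 i; rewrite ?pconsS ?pcons0.
Qed.

Section MultiIndex.
Variable n : nat.

Definition multi := {ffun 'I_n -> nat}.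

Definition mdeg (eta : multi) : nat := (\sum_i eta i)%N.

Definition mle (eta nu : multi) : bool := [forall i, (eta i <= nu i)%N].

Definition munit (i : 'I_n) : multi := [ffun j => (j == i : nat)].

Definition msupp (eta : multi) : {set 'I_n} := [set i | eta i != 0%N]%SET.

(* The finite type of the multi-indices eta <= nu. *)
Definition mbelow (nu : multi) := {dffun forall i : 'I_n, 'I_(nu i).+1}.

Definition mbelow_val (nu : multi) (eta : mbelow nu) : multi :=
  [ffun i => (eta i : nat)].

(* The list 0, .., 0, 1, .., 1, .. where each index i occurs eta i times. *)
Definition mseq (eta : multi) : seq 'I_n :=
  flatten [seq nseq (eta i) i | i <- enum 'I_n].

End MultiIndex.

Coercion mbelow_val : mbelow >-> multi.

Definition mcons (n : nat) (k : nat) (eta : multi n) : multi n.+1 :=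
  [ffun i => oapp eta k (unlift ord0 i)].

Section Derivatives.
Context {R : realType} {n : nat}.
Implicit Types (g : 'rV[R]_n -> R) (eta nu : multi n).

Definition partial (i : 'I_n) g : 'rV[R]_n -> R :=
  fun x => 'D_(delta_mx ord0 i) g x.

Definition iter_partial (s : seq 'I_n) g : 'rV[R]_n -> R := foldr partial g s.

Fixpoint ex_iter_partial (s : seq 'I_n) g : Prop :=
  if s is i :: s' then
    ex_iter_partial s' g /\
    forall x, derivable (iter_partial s' g) x (delta_mx ord0 i)
  else True.

(* D^eta g is the iterated derivative d_0^(eta_0) (.. (d_(n-1)^(eta_(n-1)) g));
   the library's 'D_v g x is an unspecified value where g is not derivable,
   so existence is a separate predicate. *)
Definition mderiv eta g := iter_partial (mseq eta) g.
Definition ex_mderiv eta g := ex_iter_partial (mseq eta) g.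

Definition Cmulti nu g : Prop :=
  forall eta, mle eta nu -> ex_mderiv eta g /\ continuous (mderiv eta g).

Definition test_function g : Prop :=
  (forall nu, Cmulti nu g) /\ compact (closure [set x | g x != 0]).

Definition loc_integrable g : Prop :=
  measurable_fun setT g /\
  forall K, compact K -> (\int[lebesgue_rV R n]_(x in K) `|g x|%:E < +oo)%E.

Definition is_weak_deriv eta g (w : 'rV[R]_n -> R) : Prop :=
  loc_integrable w /\
  forall f, test_function f ->
    \int[lebesgue_rV R n]_x (g x * mderiv eta f x) =
    (-1) ^+ mdeg eta * \int[lebesgue_rV R n]_x (w x * f x).

(* The weak derivative (a version of it, chosen arbitrarily). *)
Definition weak_deriv eta g : 'rV[R]_n -> R :=
  xget (fun=> 0) [set w | is_weak_deriv eta g w].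

End Derivatives.

Section Spaces.
Context {R : realType} {n : nat}.
Variables (gamma : {set 'I_n} -> R) (psi rho : 'I_n -> R -> R).
Implicit Types (g : 'rV[R]_n -> R) (eta nu : multi n).

(* psi_eta(y_eta) * rho_(-eta)(y_(-eta)) *)
Definition weight eta (y : 'rV[R]_n) : R :=
  (\prod_(i | eta i != 0%N) psi i (y ord0 i)) *
  (\prod_(i | eta i == 0%N) rho i (y ord0 i)).

Definition Hnorm_sq nu g : \bar R :=
  (\sum_(eta : mbelow nu) (gamma (msupp eta))^-1%:E *
     \int[lebesgue_rV R n]_y (`|weak_deriv eta g y| ^+ 2 * weight eta y)%:E)%E.

Definition Hnorm nu g : \bar R := sqrte (Hnorm_sq nu g).

Definition in_H nu g : Prop :=
  [/\ loc_integrable g,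
      forall eta, mle eta nu -> exists w, is_weak_deriv eta g w &
      (Hnorm nu g < +oo)%E].

End Spaces.

Section OneDim.
Context {R : realType}.
Implicit Types rho : R -> R.

(* Probability densities with support R. *)
Definition is_density rho : Prop :=
  [/\ measurable_fun setT rho,
      forall x, 0 <= rho x,
      (\int[@lebesgue_measure R]_x (rho x)%:E = 1)%E &
      closure [set x | rho x != 0] = setT].

Definition cdf_of rho (z : R) : R :=
  \int[@lebesgue_measure R]_(x in `]-oo, z]) rho x.

Definition Ck (k : nat) rho : Prop :=
  (forall j x, (j < k)%N -> derivable (derive1n j rho) x 1) /\
  (forall j, (j <= k)%N -> continuous (derive1n j rho)).

Definition ind (z : R) : R := if 0 <= z then 1 else 0.

End OneDim.

Section Preintegration.
Context {R : realType} {d : nat}.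
Variables (gamma : {set 'I_d.+1} -> R) (psi rho : 'I_d.+1 -> R -> R).
Variable phi : 'rV[R]_d.+1 -> R.
Implicit Types (nu eta : multi d) (t : R).

(* The data of the space over R^d, with indices 1, .., d. *)
Definition gammaS (u : {set 'I_d}) : R := gamma [set lift ord0 i | i in u]%SET.
Definition psiS (i : 'I_d) : R -> R := psi (lift ord0 i).
Definition rhoS (i : 'I_d) : R -> R := rho (lift ord0 i).

Definition admissible nu : Prop :=
  let nu' := mcons (mdeg nu).+1 nu in
  [/\ forall x, 0 < partial ord0 phi x,
      forall y, phi (pcons y0 y) @[y0 --> +oo] --> +oo,
      in_H gamma psi rho nu' phi /\ Cmulti nu' phi &
      Ck (mdeg nu) (rho ord0)].

Definition Ut t : set 'rV[R]_d := [set y | exists y0, phi (pcons y0 y) = t].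

Definition xi t y : R := xget 0 [set y0 | phi (pcons y0 y) = t].

Definition boundary (A : set 'rV[R]_d) := closure A `\` A°.

(* The constraints on the parameters r, beta, alpha_l of a function of type
   (q, eta).  The bounds "<= .. - 1" are written as strict inequalities and the
   exponent r + q - 1 is required to be a natural number. *)
Definition type_params (q : nat) eta (r beta : nat)
    (alpha : 'I_r -> multi d.+1) : Prop :=
  [/\ forall l, alpha l != 0 /\ alpha l != munit ord0,
      (r < 2 * mdeg eta + q)%N,
      forall l, (alpha l ord0 <= mdeg eta + q)%N,
      (beta < mdeg eta + q)%N &
      (0 < r + q)%N /\
      munit ord0 *+ beta + \sum_l alpha l = mcons (r + q).-1 eta].

Definition hfun (q r beta : nat) (alpha : 'I_r -> multi d.+1) t y : R :=
  let x := pcons (xi t y) y in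
  ((-1) ^+ r * derive1n beta (rho ord0) (xi t y) * \prod_l mderiv (alpha l) phi x) /
  partial ord0 phi x ^+ (r + q).

Definition decay_condition (a b : R) (q : nat) eta (B : R) : Prop :=
  forall (r beta : nat) (alpha : 'I_r -> multi d.+1),
    type_params q eta beta alpha ->
    (forall t, t \in `[a, b] -> forall z, boundary (Ut t) z ->
       hfun q beta alpha t @ within (Ut t) (nbhs z) --> (0 : R)) /\
    (ereal_sup [set \int[lebesgue_rV R d]_(y in Ut t)
       (`|hfun q beta alpha t y| ^+ 2 * weight psiS rhoS eta y)%:E
       | t in `[a, b]] <= B%:E)%E.

Definition gfun t (x : 'rV[R]_d.+1) : R := ind (t - phi x).

Definition P0 (g : 'rV[R]_d.+1 -> R) y : R :=
  \int[@lebesgue_measure R]_y0 (g (pcons y0 y) * rho ord0 y0).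

End Preintegration.

(* Main.v *)
Require Import Defs.
From mathcomp Require Import all_boot all_order all_algebra.
From mathcomp Require Import all_classical all_reals all_analysis.
From mathcomp Require Import measurable_realfun ring lra zify.

(** The integrand g_t (., y) is the indicator function of the half-line up to the
    point xi (t, y) where phi (., y) crosses the level t, because phi is strictly
    increasing in y_0. So P_0 g_t = Phi_0 (xi) on the set U_t of the y for which
    there is a crossing. Off U_t the function phi (., y), being unbounded above,
    stays above t, and P_0 g_t = 0. The set U_t is open, and by the implicit function
    theorem xi is differentiable on it with D^i xi = - D^i phi / D^0 phi
    ([xi_near], [is_derive_xi]).

    _Derivatives on U_t._ Put m_alpha = - D^alpha phi / D^0 phi, evaluated at
    (xi y, y). The functions of type (0, eta) are exactly the products of a derivative
    of rho_0 at xi and of ratios m_alpha, subject to the stated constraints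
    ([hfun_term_value]). The derivative of Phi_0 (xi) along i is rho_0 (xi) m_(e_i),
    and the derivative of m_alpha is a sum of four products of such ratios
    ([is_derive_level_ratio]). Hence D^eta P_0 g_t is a sum of functions of type
    (0, eta) ([typed_deriv_terms]). A function of type (0, eta) has at most
    2 |eta| - 1 ratios, hence at most 8 |eta| derivative terms, so the sum has at
    most 8^(|eta| - 1) (|eta| - 1)! terms ([size_deriv_terms]). The order in
    which derivatives are taken is immaterial by a form of Schwarz's theorem
    ([schwarz], [iter_partial_mderiv]).

    _Derivatives across the boundary._ At the boundary of U_t the point xi tends to
    -oo, so P_0 g_t is continuous ([P0_cont]). The decay condition says that the
    functions of type (0, eta), extended by 0 off U_t, are continuous. A continuous
    function that vanishes off an open set, and whose derivative on that set extends
    continuously by 0, is differentiable everywhere, with the extended derivative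
    ([is_derive_zero_extension]). By induction P_0 g_t is of class C^nu, and the
    formula for its derivatives holds everywhere, with 0 off U_t ([mderiv_P0]).

    _The norm._ The norm is made of weak derivatives, which are determined only almost
    everywhere. Integration by parts shows that the classical derivatives are weak
    derivatives ([is_weak_deriv_mderiv]), and the du Bois-Reymond lemma that any
    others agree with them almost everywhere ([du_bois_reymond]). For eta <> 0 the
    Cauchy-Schwarz inequality bounds the squared norm of a sum of N functions, each of
    squared norm at most B, by N^2 B ([integral_mderiv_P0_le]). For eta = 0 the
    contribution is at most 1 because 0 <= P_0 g_t <= 1 and the weight is a
    probability density ([integral_sqr_P0_le1]). *)

Set Implicit Arguments.
Unset Strict Implicit.
Unset Printing Implicit Defensive.

Import Order.TTheory GRing.Theory Num.Theory.
Import numFieldNormedType.Exports.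

Local Open Scope classical_set_scope.
Local Open Scope ring_scope.

(** * Differentiation along lines and zero extension *)

Section DirectionalDerivative.
Context {R : realType} {V : normedModType R}.
Implicit Types (f g u : V -> R) (v w x : V).

(** Multiplying the difference quotient out removes both the division and the
    excluded point h = 0, so that a directional derivative becomes an inequality to
    which mean value estimates apply as they are. *)
Lemma is_derive_epsP f x v l :
  is_derive x v f l <->
  forall e, 0 < e -> exists2 d, 0 < d &
    forall h, `|h| < d -> `|f (h *: v + x) - f x - h * l| <= e * `|h|.
Proof.
have -> : is_derive x v f l <->
    (fun h => h^-1 *: ((f \o shift x) (h *: v) - f x)) @ 0^' --> l.
  split; first by case=> cf <-.
  move=> fl; split; first by apply/cvg_ex; exists l.
  exact: cvg_lim fl.
split=> [/cvgrPdist_le fl e e0|H].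
  have := fl _ e0; rewrite near_withinE => /nbhs_ballP[d /= d0 dP].
  exists d => // h hd; have [->|h0] := eqVneq h 0.
    by rewrite scale0r add0r subrr mul0r subrr normr0 mulr0.
  have /= {}dP := dP h.
  rewrite -ball_normE /= sub0r normrN in dP; have {}dP := dP hd h0.
  have -> : f (h *: v + x) - f x - h * l =
      - h * (l - h^-1 * (f (h *: v + x) - f x)).
    by rewrite mulNr mulrBr mulrA divff// mul1r opprB.
  by rewrite normrM normrN mulrC ler_wpM2r.
apply/cvgrPdist_le => e e0; have [d d0 dP] := H _ e0.
rewrite near_withinE; apply/nbhs_ballP; exists d => //= h.
rewrite -ball_normE /= sub0r normrN => hd h0.
have := dP h hd.
have -> : f (h *: v + x) - f x - h * l =
    - h * (l - h^-1 * (f (h *: v + x) - f x)).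
  by rewrite mulNr mulrBr mulrA divff// mul1r opprB.
by rewrite normrM normrN mulrC ler_pM2r// normr_gt0.
Qed.

End DirectionalDerivative.

Section AlongLines.
Context {R : realType} {V : normedModType R}.
Implicit Types (f g u : V -> R) (v w x : V).

Lemma is_derive_line f x v l (s : R) : is_derive (s *: v + x) v f l ->
  is_derive (s : R) (1 : R) (fun r : R => f (r *: v + x)) l.
Proof.
rewrite !is_derive_epsP => H e /H[d d0 dP]; exists d => // h /dP.
by rewrite scalerDl addrA [_ *: 1]mulr1.
Qed.

Lemma is_derive_of_line f x v l :
  is_derive (0 : R) (1 : R) (fun r : R => f (r *: v + x)) l -> is_derive x v f l.
Proof.
rewrite !is_derive_epsP => H e /H[d d0 dP]; exists d => // h /dP.
by rewrite addr0 [_ *: 1]mulr1 scale0r add0r.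
Qed.

Lemma MVT_line f v : (forall x, derivable f x v) ->
  forall x s, exists2 c, `|c| <= `|s| &
    f (s *: v + x) - f x = s * 'D_v f (c *: v + x).
Proof.
move=> df x s; pose g r := f (r *: v + x).
have dg r : is_derive (r : R) (1 : R) g ('D_v f (r *: v + x)).
  by apply: (@is_derive_line f x v); exact: derivableP.
have cg : continuous g.
  by move=> r; apply/differentiable_continuous/derivable1_diffP; case: (dg r).
have g0 : g 0 = f x by rewrite /g scale0r add0r.
have [s0|s0] := leP 0 s.
  have [|c cs] := MVT_segment s0 (fun r _ => dg r).
    exact: continuous_subspaceT.
  rewrite g0 subr0 mulrC => E; exists c => //.
  by move: cs; rewrite in_itv/= => /andP[? ?]; rewrite !ger0_norm.
have [|c cs] := MVT_segment (ltW s0) (fun r _ => dg r).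
  exact: continuous_subspaceT.
rewrite g0 sub0r mulrN => E; exists c => //.
  by move: cs; rewrite in_itv/= => /andP[? ?]; rewrite !ler0_norm ?lerN2// ltW.
by apply: oppr_inj; rewrite opprB -/(g s) E mulrC.
Qed.

(** A mean value point obtained by moving along v and then along w is only known
    through the sizes of its two parameters; this is the continuity estimate for it. *)
Lemma continuous_plane g x v w : {for x, continuous g} ->
  forall e, 0 < e -> exists2 d, 0 < d & forall a b, `|a| < d -> `|b| < d ->
    `|g (a *: v + (b *: w + x)) - g x| <= e.
Proof.
move=> cg e e0.
pose h (p : R * R) := g (p.1 *: v + (p.2 *: w + x)).
have ch : {for (0, 0), continuous h}.
  apply: continuous_comp => /=; last by rewrite !scale0r !add0r.
  apply: cvgD; first by apply: cvgZr_tmp => //; exact: cvg_fst.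
  by apply: cvgD; [apply: cvgZr_tmp => //; exact: cvg_snd|exact: cvg_cst].
have := ch; rewrite /continuous_at => /cvgrPdist_le/(_ _ e0)/nbhs_ballP[d /= d0 dP].
exists d => // a b ad bd; have /= := dP (a, b).
rewrite distrC /h /= !scale0r !add0r; apply.
by split; rewrite /= -ball_normE /= sub0r normrN.
Qed.

End AlongLines.

Section AlongPlanes.
Context {R : realType} {V : normedModType R}.
Implicit Types (f g u : V -> R) (v w x : V).

(** A Lipschitz estimate at a point bounds the derivative there; it replaces
    passing to the limit inside an inequality. *)
Lemma is_derive_le_norm (k : R -> R) l M d : 0 < d -> is_derive (0 : R) (1 : R) k l ->
  (forall h, `|h| < d -> `|k h - k 0| <= M * `|h|) -> `|l| <= M.
Proof.
move=> d0 /is_derive_epsP dk kM; apply/ler_addgt0Pr => e e0.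
have [d' d'0 dP] := dk _ e0.
pose h := Num.min d d' / 2; have h0 : 0 < h by rewrite divr_gt0// lt_min d0.
have hd : `|h| < Num.min d d'.
  by rewrite gtr0_norm// ltr_pdivrMr// ltr_pMr ?ltr1n// lt_min d0.
have := dP h (lt_le_trans hd _); rewrite ge_min lexx orbT => /(_ isT).
have := kM h (lt_le_trans hd _); rewrite ge_min lexx => /(_ isT).
have -> : h *: 1 + 0 = h by rewrite addr0 [LHS]mulr1.
move=> H1 H2; rewrite -(ler_pM2r (x := `|h|)); last by rewrite normr_gt0 gt_eqF.
rewrite -normrM mulrC mulrDl; apply: le_trans (lerD H1 H2).
rewrite (_ : `|h * l| = `|(k h - k 0) - (k h - k 0 - h * l)|); last first.
  by congr (`| _ |); ring.
exact: ler_normB.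
Qed.

(** Schwarz's theorem in the form where only one of the two mixed derivatives is
    assumed to exist, and the existence of the other is part of the conclusion. This
    strength is needed because membership in a space C^nu speaks of the derivatives
    taken in one fixed order of the variables. The second difference of u with steps
    s v and r w is r s times a value of D_w D_v u near x, hence close to r s A;
    letting r tend to 0 turns it into a first difference of D_w u with step s v. *)
Lemma schwarz u v w :
    (forall x, derivable u x v) -> (forall x, derivable u x w) ->
    (forall x, derivable ('D_v u) x w) -> continuous ('D_w ('D_v u)) ->
  forall x, is_derive x v ('D_w u) ('D_w ('D_v u) x).
Proof.
move=> duv duw dvw cvw x; set A := 'D_w _ x.
apply/is_derive_epsP => e e0.
have [d d0 dP] := continuous_plane v w (cvw x) e0.
exists d => // s sd.
(* k is the second difference minus r s A, up to the constant k 0; its slope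
   at r = 0 is the error in the difference quotient of D_w u. *)
pose k r := u (r *: w + (s *: v + x)) - u (r *: w + x) - r * (s * A).
have dk : is_derive (0 : R) (1 : R) k ('D_w u (s *: v + x) - 'D_w u x - s * A).
  have d1 y : is_derive (0 : R) (1 : R) (fun r => u (r *: w + y)) ('D_w u y).
    apply: (@is_derive_line R V u y w); rewrite scale0r add0r; exact: derivableP.
  rewrite /k; apply: is_deriveB.
  apply/is_derive_epsP => e' e'0; exists 1 => // h _.
  rewrite (_ : _ - _ = 0) ?normr0 ?mulr_ge0 ?(ltW e'0)//.
  by rewrite addr0 [h *: 1]mulr1 mul0r !subr0 subrr.
apply: (is_derive_le_norm d0 dk) => r rd.
have [c cs E1] : exists2 c, `|c| <= `|s| &
    u (s *: v + (r *: w + x)) - u (r *: w + x) - (u (s *: v + x) - u x)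
    = s * ('D_v u (r *: w + (c *: v + x)) - 'D_v u (c *: v + x)).
  pose f y := u (r *: w + y) - u y.
  have df y : is_derive y v f ('D_v u (r *: w + y) - 'D_v u y).
    have ? : is_derive y v (fun y => u (r *: w + y)) ('D_v u (r *: w + y)).
      apply/is_derive_epsP => e' e'0.
      have /is_derive_epsP/(_ _ e'0)[d' d'0 d'P] := derivableP (duv (r *: w + y)).
      by exists d' => // h /d'P; rewrite addrCA.
    by apply: is_deriveB; exact: derivableP.
  have [y|c cs] := @MVT_line R V f v _ x s; first by case: (df y).
  by rewrite derive_val => E; exists c => //; rewrite -E /f (addrCA (s *: v)); ring.
have [c' cr E2] := MVT_line dvw (c *: v + x) r.
rewrite E2 in E1.
have k0 : k 0 = u (s *: v + x) - u x by rewrite /k scale0r !add0r mul0r subr0.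
have Ew : c' *: w + (c *: v + x) = c *: v + (c' *: w + x) by rewrite addrCA.
have Es : r *: w + (s *: v + x) = s *: v + (r *: w + x) by rewrite addrCA.
rewrite {}k0 /k Es; move: E1; rewrite {}Ew.
have := dP c c' (le_lt_trans cs sd) (le_lt_trans cr rd).
set G := 'D_w _ _; rewrite -/A => GA E1.
have -> : u (s *: v + (r *: w + x)) - u (r *: w + x) - r * (s * A) -
    (u (s *: v + x) - u x) = s * (r * (G - A)).
  have gen (a b y z A' G' : R) : a - b - (y - z) = s * (r * G') ->
      a - b - r * (s * A') - (y - z) = s * (r * (G' - A')).
    by rewrite 2!mulrBr => <-; ring.
  exact: gen.
by rewrite !normrM mulrA [leLHS]mulrC mulrA !ler_wpM2r.
Qed.

(** The point moves on the curve s w + X(s) v + c. Going first along v is the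
    one-variable chain rule; the remaining displacement along w is a mean value
    step, which is why D_w g has to be continuous at the base point while D_v g only
    has to exist. *)
Lemma is_derive_curve g v w (X : R -> R) X' c :
    (forall x, derivable g x v) -> (forall x, derivable g x w) ->
    {for X 0 *: v + c, continuous ('D_w g)} -> is_derive (0 : R) (1 : R) X X' ->
  is_derive (0 : R) (1 : R) (fun s => g (s *: w + (X s *: v + c)))
    (X' * 'D_v g (X 0 *: v + c) + 'D_w g (X 0 *: v + c)).
Proof.
move=> dv dw cw dX; set p := X 0 *: v + c.
pose F s := g (X s *: v + c).
have dF : is_derive (0 : R) (1 : R) F (X' * 'D_v g p).
  rewrite mulrC.
  have dg : is_derive (X 0) (1 : R) (fun r : R => g (r *: v + c)) ('D_v g p).
    exact: (@is_derive_line R V g c v _ (X 0) (derivableP (dv p))).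
  exact: (is_derive1_comp dg dX).
apply/is_derive_epsP => e e0; have e20 : 0 < e / 2 by rewrite divr_gt0.
have /is_derive_epsP/(_ _ e20)[d1 d10 d1P] := dF.
have [d2 d20 d2P] := continuous_plane w v cw e20.
have cX : {for 0, continuous X}.
  by apply/differentiable_continuous/derivable1_diffP; case: dX.
have /cvgrPdist_lt/(_ _ d20)/nbhs_ballP[d3 /= d30 d3P] := cX.
exists (Num.min d1 (Num.min d2 d3)); first by rewrite !lt_min d10 d20.
move=> h; rewrite !lt_min => /and3P[h1 h2 h3].
have [t th E] := MVT_line dw (X h *: v + c) h.
have {d1P}H1 := d1P _ h1; rewrite addr0 [h *: 1]mulr1 in H1 *.
have H2 : `|'D_w g (t *: w + (X h *: v + c)) - 'D_w g p| <= e / 2.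
  have -> : X h *: v + c = (X h - X 0) *: v + p.
    by rewrite addrA -scalerDl subrK.
  apply: d2P; first exact: le_lt_trans th h2.
  by rewrite distrC; apply: d3P; rewrite -ball_normE /= sub0r normrN.
have -> : g (h *: w + (X h *: v + c)) - g (0 *: w + p) - h * (X' * 'D_v g p + 'D_w g p)
   = (F h - F 0 - h * (X' * 'D_v g p)) +
     h * ('D_w g (t *: w + (X h *: v + c)) - 'D_w g p).
  by rewrite mulrBr -E /F -/p scale0r add0r; ring.
rewrite (splitr e) mulrDl (le_trans (ler_normD _ _))// lerD// normrM mulrC.
by rewrite ler_wpM2r.
Qed.

(** Where k vanishes nothing is known about its derivative. The mean value theorem
    is applied between the last zero of k before s and s, so that k does not vanish
    in between. *)
Lemma le_norm_of_small_derivative (k D : R -> R) e s : 0 <= s ->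
    continuous k -> k 0 = 0 ->
    (forall r : R, 0 <= r <= s -> k r != 0 -> is_derive (r : R) (1 : R) k (D r)) ->
    (forall r : R, 0 <= r <= s -> `|D r| <= e) -> `|k s| <= e * s.
Proof.
move=> s0 ck k0 dk De.
pose Z := [set r : R | 0 <= r <= s /\ k r = 0].
have supZ : has_sup Z.
  split; first by exists 0; split; rewrite ?lexx.
  by exists s => r [/andP[]].
have Za : Z (sup Z).
  suff cZ : closed Z.
    by have := closure_sup supZ.1 supZ.2; rewrite -(closure_id Z).1.
  rewrite (_ : Z = `[0, s]%classic `&` k @^-1` [set 0]); last first.
    by apply/seteqP; split => r /=; rewrite in_itv/=.
  apply: closedI; first exact: itv_closed.
  apply: closed_comp => [r _|]; [exact: ck|exact: closed_eq].
set a := sup Z in Za; case: Za => /andP[a0 as_] ka.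
have [|c ca E] := @MVT_segment _ k D a s as_ _ (continuous_subspaceT ck).
  move=> r; rewrite in_itv/= => /andP[ar rs].
  have r0s : 0 <= r <= s by rewrite (ltW (le_lt_trans a0 ar)) ltW.
  apply: dk => //; apply/eqP => kr.
  by have := ub_le_sup supZ.2 (conj r0s kr : Z r); rewrite leNgt ar.
move: ca; rewrite in_itv/= => /andP[ac cs].
move: E; rewrite ka subr0 => ->; rewrite normrM.
rewrite ler_pM//; first by apply: De; rewrite (le_trans a0 ac).
by rewrite ger0_norm ?subr_ge0// gerBl.
Qed.

(** At a point y outside U the candidate derivative is 0, and D is small near y by
    continuity. A segment starting at y may leave and enter U infinitely often, but g
    vanishes whenever it is outside, so the estimate from the last zero applies and
    gives g = o(h). *)
Lemma is_derive_zero_extension (U : set V) g D v : open U -> continuous g ->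
    (forall y, ~ U y -> g y = 0) -> continuous D -> (forall y, ~ U y -> D y = 0) ->
    (forall y, U y -> is_derive y v g (D y)) ->
  forall y, is_derive y v g (D y).
Proof.
move=> oU cg g0 cD D0 dg y; have [/dg//|Uy] := pselect (U y).
rewrite D0//; apply/is_derive_epsP => e e0.
have [d d0 dP] := continuous_plane v v (cD y) e0.
have small w (E : V -> R) : (forall r : R, g (r *: w + y) != 0 ->
      is_derive (r *: w + y) w g (E (r *: w + y))) ->
    (forall h : R, `|h| < d -> `|E (h *: w + y)| <= e) ->
    forall h, 0 <= h -> h < d -> `|g (h *: w + y)| <= e * h.
  move=> dgw Dw h h0 hd.
  apply: (@le_norm_of_small_derivative (fun r => g (r *: w + y)) (fun r => E (r *: w + y))) => //.
  - move=> r; apply: continuous_comp; last exact: cg.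
    by apply: cvgD; [apply: cvgZr_tmp; exact: cvg_id|exact: cvg_cst].
  - by rewrite scale0r add0r g0.
  - by move=> r _ gr; apply: (@is_derive_line R V g y w _ r); exact: dgw.
  - move=> r /andP[r0 rh]; apply: Dw; rewrite ger0_norm//; exact: le_lt_trans hd.
have gU z : g z != 0 -> U z by move=> /eqP gz; apply: contrapT => /g0.
have Dv h : `|h| < d -> `|D (h *: v + y)| <= e.
  by move=> hd; have := dP h 0 hd; rewrite normr0 scale0r add0r (D0 y)// subr0; exact.
exists d => // h hd; rewrite (g0 y)// subr0 mulr0 subr0.
have [h0|h0] := leP 0 h.
  rewrite (ger0_norm h0); apply: (small v D) => //; last by rewrite -(ger0_norm h0).
  by move=> r /gU; exact: dg.
have -> : h *: v = (- h) *: (- v) by rewrite scalerN scaleNr opprK.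
rewrite (ltr0_norm h0).
apply: (small (- v) (fun z => - D z)).
- move=> r /gU /dg/is_derive_epsP H; apply/is_derive_epsP => e' /H[d' d'0 d'P].
  exists d' => // h' h'd; have := d'P (- h'); rewrite normrN => /(_ h'd).
  by rewrite (scalerN h') -(scaleNr h') mulrN mulNr.
- by move=> h' h'd; rewrite normrN scalerN -scaleNr; apply: Dv; rewrite normrN.
- by rewrite oppr_ge0 ltW.
- by rewrite -(ltr0_norm h0).
Qed.

Lemma continuous_zero_extension (U : set V) g : open U ->
    (forall y, U y -> {for y, continuous g}) ->
    (forall z, ~ U z -> g @ within U (nbhs z) --> (0 : R)) ->
  continuous (fun y => if y \in U then g y else 0).
Proof.
move=> oU cg g0 y; set G := fun _ => _.
have [Uy|Uy] := pselect (U y).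
  rewrite /continuous_at {2}/G mem_set//; apply: cvg_trans (cg _ Uy).
  apply: near_eq_cvg; near=> z; rewrite /G mem_set//.
  by near: z; exact: open_nbhs_nbhs.
rewrite /continuous_at {2}/G memNset//.
apply/cvgrPdist_le => e e0.
have /cvgrPdist_le/(_ _ e0) := g0 _ Uy.
rewrite near_withinE; apply: filterS => z zU; rewrite /G.
by case: ifPn => [/[1!inE]/zU//|_]; rewrite subr0 normr0 ltW.
Unshelve. all: by end_near. Qed.

End AlongPlanes.

(** * Mixed partial derivatives in any order *)

Section Multi.
Variable n : nat.
Implicit Types (s t : seq 'I_n) (i j k : 'I_n) (eta nu : multi n).

Definition mcount s : multi n := [ffun i => count_mem i s].

Definition ord_leq : rel 'I_n := fun i j => (i <= j)%N.

Lemma ord_leq_trans : transitive ord_leq.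
Proof. by move=> j i k; exact: leq_trans. Qed.

Lemma ord_leq_anti : antisymmetric ord_leq.
Proof. by move=> i j /anti_leq/val_inj. Qed.

Lemma count_mseq eta i : count_mem i (mseq eta) = eta i.
Proof.
rewrite /mseq count_flatten -map_comp sumnE big_map big_enum /=.
rewrite (bigD1 i)//= count_nseq /= eqxx mul1n big1 ?addn0// => j /negPf ji.
by rewrite count_nseq /= ji.
Qed.

Lemma mcount_mseq eta : mcount (mseq eta) = eta.
Proof. by apply/ffunP => i; rewrite ffunE count_mseq. Qed.

Lemma sorted_mseq eta : sorted ord_leq (mseq eta).
Proof.
rewrite sorted_pairwise; last exact: ord_leq_trans.
have : pairwise ord_leq (enum 'I_n).
  rewrite -sorted_pairwise; last exact: ord_leq_trans.
  have := iota_sorted 0 n; rewrite -val_enum_ord.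
  by rewrite sorted_map.
rewrite /mseq; elim: (enum 'I_n) => //= i s IH /andP[iS /IH sS].
rewrite pairwise_cat sS andbT; apply/andP; split.
  apply/allrelP => x y /nseqP[-> _] /flatten_mapP[j js /nseqP[-> _]].
  by move/allP : iS; apply.
elim: (eta i) => //= m ->; rewrite andbT.
by apply/allP => x /nseqP[-> _]; rewrite /ord_leq.
Qed.

Lemma mcount_perm s t : perm_eq s t -> mcount s = mcount t.
Proof. by move=> /permP st; apply/ffunP => i; rewrite !ffunE; apply: st. Qed.

Lemma perm_mseq s : perm_eq (mseq (mcount s)) s.
Proof. by apply/allP => i _ /=; rewrite count_mseq ffunE. Qed.

Lemma sorted_mseqE s : sorted ord_leq s -> mseq (mcount s) = s.
Proof.
move=> ss; apply: (sorted_eq ord_leq_trans ord_leq_anti) => //.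
  exact: sorted_mseq.
exact: perm_mseq.
Qed.

Lemma mcount_cons i s : mcount (i :: s) = mcount s + munit i.
Proof. by apply/ffunP => j; rewrite !ffunE /= addnC eq_sym. Qed.

Lemma mle_mcountW i s nu : mle (mcount (i :: s)) nu -> mle (mcount s) nu.
Proof.
move=> /forallP H; apply/forallP => j; apply: leq_trans (H j).
by rewrite mcount_cons !ffunE leq_addr.
Qed.

Lemma mdeg_mcount s : mdeg (mcount s) = size s.
Proof.
elim: s => [|i s IH]; first by rewrite /mdeg big1// => i _; rewrite ffunE.
rewrite mcount_cons /= -IH /mdeg -addn1 -[in RHS](_ : \sum_j munit i j = 1)%N.
  by rewrite -big_split; apply: eq_bigr => j _; rewrite ffunE.
by rewrite (bigD1 i)//= ffunE eqxx big1// => j /negPf ji; rewrite ffunE ji.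
Qed.

End Multi.

Section MixedPartials.
Context {R : realType} {n : nat}.
Implicit Types (f : 'rV[R]_n -> R) (s t : seq 'I_n) (eta nu : multi n).

(** The definition of the space C^nu controls a further derivative D_i only if
    the list stays sorted. Otherwise i is moved past the head k of the list: the
    derivative D_i after the shorter list is known by induction, D_k after that one is a
    sorted derivative, and Schwarz's theorem exchanges the two and provides the
    existence of the derivative in the order D_i D_k. *)
Lemma partial_iter_sorted nu f i t : Cmulti nu f ->
  sorted (@ord_leq n) t -> mle (mcount (i :: t)) nu ->
  (forall x, derivable (iter_partial t f) x (delta_mx ord0 i)) /\
  partial i (iter_partial t f) = mderiv (mcount (i :: t)) f.
Proof.
move=> Cf; have direct j s : sorted (@ord_leq n) (j :: s) ->
    mle (mcount (j :: s)) nu ->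
    (forall x, derivable (iter_partial s f) x (delta_mx ord0 j)) /\
    partial j (iter_partial s f) = mderiv (mcount (j :: s)) f.
  move=> ss /Cf[]; rewrite /ex_mderiv /mderiv sorted_mseqE//=.
  by case.
elim: t => [|k t IH] st le_nu; first exact: direct.
have [ik|ki] := leqP i k; first by apply: direct => //; rewrite /= /ord_leq ik.
have st' : sorted (@ord_leq n) t by exact: path_sorted st.
have le1 : mle (mcount (k :: t)) nu by exact: mle_mcountW le_nu.
have perm_ik : perm_eq (i :: k :: t) (k :: i :: t).
  by rewrite -[i :: k :: t]/([:: i] ++ [:: k] ++ t) perm_catCA.
have le2 : mle (mcount (i :: t)) nu.
  by apply: (@mle_mcountW _ k); rewrite -(mcount_perm perm_ik).
have [di Di] := IH st' le2; have [dk Dk] := direct _ _ st le1.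
have perm_t2 := perm_mseq (i :: t).
have permk : perm_eq (k :: mseq (mcount (i :: t))) (i :: k :: t).
  by rewrite perm_sym (perm_trans perm_ik)// perm_cons perm_sym.
have st2 : sorted (@ord_leq n) (k :: mseq (mcount (i :: t))).
  rewrite /= path_sortedE; last exact: ord_leq_trans.
  rewrite sorted_mseq andbT (perm_all _ perm_t2) /= /ord_leq (ltnW ki)/=.
  by move: st; rewrite /= path_sortedE; [case/andP|exact: ord_leq_trans].
have le3 : mle (mcount (k :: mseq (mcount (i :: t)))) nu.
  by rewrite (mcount_perm permk).
have [dki Dki] := direct _ _ st2 le3.
have Diu : iter_partial (mseq (mcount (i :: t))) f = partial i (iter_partial t f).
  by rewrite Di.
rewrite {}Diu (mcount_perm permk) in dki Dki.
have [_ ck] := Cf _ le_nu.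
have S := @schwarz _ _ (iter_partial t f) (delta_mx ord0 i) (delta_mx ord0 k) di dk dki.
rewrite -/(partial i (iter_partial t f)) in S.
rewrite -Dki in ck *; have {}S := S ck.
split=> [x|]; first by case: (S x).
by apply/funext => x; case: (S x).
Qed.

Lemma iter_partial_mderiv nu f s : Cmulti nu f -> mle (mcount s) nu ->
  ex_iter_partial s f /\ iter_partial s f = mderiv (mcount s) f.
Proof.
move=> Cf; elim: s => [_|i s IH le_nu].
  by split => //; rewrite /mderiv sorted_mseqE.
have [exs Es] := IH (mle_mcountW le_nu).
have perm_is : perm_eq (i :: mseq (mcount s)) (i :: s).
  by rewrite perm_cons perm_mseq.
have [||d D] := @partial_iter_sorted nu f i (mseq (mcount s)) Cf.
- exact: sorted_mseq.
- by rewrite (mcount_perm perm_is).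
rewrite (mcount_perm perm_is) -/(mderiv _ _) -Es in d D.
by split => /=.
Qed.

Lemma is_derive_mderiv nu f eta i x : Cmulti nu f -> mle (eta + munit i) nu ->
  is_derive x (delta_mx ord0 i) (mderiv eta f) (mderiv (eta + munit i) f x).
Proof.
move=> Cf le_nu.
have E : mcount (i :: mseq eta) = eta + munit i by rewrite mcount_cons mcount_mseq.
have [||d D] := @partial_iter_sorted nu f i (mseq eta) Cf.
- exact: sorted_mseq.
- by rewrite E.
by rewrite -E -D; apply: derivableP; exact: d.
Qed.

Lemma mderiv0 f : mderiv 0 f = f.
Proof.
suff -> : mderiv 0 f = iter_partial [::] f by [].
by rewrite /mderiv; congr iter_partial; apply/perm_nilP/allP => i _ /=; rewrite count_mseq ffunE.
Qed.

Lemma mderiv_unit f i : mderiv (munit i) f = partial i f.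
Proof.
have -> : munit i = mcount [:: i] by rewrite mcount_cons; apply/ffunP => j; rewrite !ffunE.
by rewrite /mderiv sorted_mseqE.
Qed.

End MixedPartials.

(** * Topology, measurability and integration in coordinates *)

Section RowPoints.
Context {R : realType} {n : nat}.
Implicit Types (x y : 'rV[R]_n) (U : set 'rV[R]_n).

Lemma pconsE (y0 : R) y : pcons y0 y = y0 *: delta_mx ord0 ord0 + pcons 0 y.
Proof.
apply/rowP => i; rewrite !mxE; case: unliftP => [j ->|->] /=.
  by rewrite mulr0 add0r.
by rewrite addr0 mulr1.
Qed.

Lemma pcons_line (y0 s : R) y i :
  pcons y0 (s *: delta_mx ord0 i + y) =
  s *: delta_mx ord0 (lift ord0 i) + pcons y0 y.
Proof.
apply/rowP => j; rewrite !mxE; case: unliftP => [k ->|->] /=.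
  by rewrite !mxE (inj_eq (lift_inj)).
by rewrite mulr0 add0r.
Qed.

Lemma pcons0_line (y0 s : R) y :
  pcons (s + y0) y = s *: delta_mx ord0 ord0 + pcons y0 y.
Proof. by rewrite (pconsE (s + y0)) (pconsE y0) scalerDl addrA. Qed.

Lemma nbhs_rVP (x : 'rV[R]_n) (A : set 'rV[R]_n) : nbhs x A <->
  exists2 e, 0 < e & forall y, (forall i, `|y ord0 i - x ord0 i| < e) -> A y.
Proof.
split=> [/nbhs_ballP[e /= e0 eA]|[e e0 eA]].
  exists e => // y xy; apply: eA; split => // i j.
  by rewrite -ball_normE /= distrC (ord1 i).
apply/nbhs_ballP; exists e => //= y [_ xy]; apply: eA => i.
by have := xy ord0 i; rewrite -ball_normE /= distrC.
Qed.

Lemma cvg_rV T (F : set_system T) {FF : Filter F} (f : T -> 'rV[R]_n) x :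
  (forall i, f t ord0 i @[t --> F] --> x ord0 i) -> f @ F --> x.
Proof.
move=> fx A /nbhs_rVP[e e0 eA].
have H : \forall t \near F, forall i, `|f t ord0 i - x ord0 i| < e.
  apply: filter_forall => i; have /cvgrPdist_lt/(_ _ e0) := fx i.
  by apply: filterS => t; rewrite distrC.
by rewrite /= nbhs_simpl /=; apply: filterS H => t; exact: eA.
Qed.

End RowPoints.

Section RowPointsContinuity.
Context {R : realType} {n : nat}.

Lemma cvg_pcons T (F : set_system T) {FF : Filter F} (g : T -> R)
    (f : T -> 'rV[R]_n) (g0 : R) (x : 'rV[R]_n) :
  g @ F --> g0 -> f @ F --> x -> pcons (g t) (f t) @[t --> F] --> pcons g0 x.
Proof.
move=> gg0 fx; apply: cvg_rV => i; case: (unliftP ord0 i) => [j ->|->].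
  rewrite pconsS; under eq_fun do rewrite pconsS.
  exact: (@cvg_comp _ _ _ f (fun y : 'rV[R]_n => y ord0 j) _ _ _ fx (@coord_continuous _ _ _ _ _ x)).
by rewrite pcons0; under eq_fun do rewrite pcons0.
Qed.

Lemma continuous_pcons (y0 : R) : continuous (pcons y0 : 'rV[R]_n -> 'rV[R]_n.+1).
Proof. by move=> y; exact: (@cvg_pcons _ (nbhs y) _ (fun=> y0) id y0 y (cvg_cst y0) cvg_id). Qed.

Lemma continuous_pcons0 (y : 'rV[R]_n) : continuous (fun y0 => pcons y0 y).
Proof. by move=> y0; exact: (@cvg_pcons _ (nbhs y0) _ id (fun=> y) y0 y cvg_id (cvg_cst y)). Qed.

Lemma partial_pcons (F : 'rV[R]_n.+1 -> R) y0 y i :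
  partial i (F \o pcons y0) y = partial (lift ord0 i) F (pcons y0 y) /\
  (derivable F (pcons y0 y) (delta_mx ord0 (lift ord0 i)) ->
   derivable (F \o pcons y0) y (delta_mx ord0 i)).
Proof.
rewrite /partial /derive /derivable.
have -> : (fun h => h^-1 *: (((F \o pcons y0) \o shift y) (h *: delta_mx ord0 i)
      - (F \o pcons y0) y)) =
    (fun h => h^-1 *: ((F \o shift (pcons y0 y)) (h *: delta_mx ord0 (lift ord0 i))
      - F (pcons y0 y))).
  by apply/funext => h /=; rewrite pcons_line.
by split.
Qed.

Lemma is_derive_pcons0 (F : 'rV[R]_n.+1 -> R) (y0 : R) y l :
  is_derive (pcons y0 y) (delta_mx ord0 ord0) F l ->
  is_derive (y0 : R) (1 : R) (fun r : R => F (pcons r y)) l.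
Proof.
rewrite pconsE => /(@is_derive_line R _ F (pcons 0 y) (delta_mx ord0 ord0)).
by under [X in _ -> is_derive _ _ X _]eq_fun do rewrite pconsE.
Qed.

End RowPointsContinuity.

Section Measurability.
Context {R : realType} {n : nat}.
Implicit Types (x y : 'rV[R]_n) (U : set 'rV[R]_n).

Lemma measurable_box (A : 'I_n -> set R) : (forall i, measurable (A i)) ->
  measurable [set x : 'rV[R]_n | forall i, A i (x ord0 i)].
Proof.
move=> mA.
rewrite (_ : mkset _ = \big[setI/setT]_(i < n) (Defs.coord i @^-1` A i)).
  apply: bigsetI_measurable => i _.
  by rewrite -[X in measurable X]setTI; exact: measurable_coord.
rewrite -bigcap_seq; apply/seteqP; split => x /= Ax i; first by move=> _; exact: Ax.
by apply: Ax => /=; rewrite mem_index_enum.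
Qed.

(** The sigma-algebra is the one generated by the coordinates, whereas continuity
    speaks of the norm topology. They match by second countability: an open set is
    the union of the rational cubes that it contains. *)
Lemma open_measurable_rV U : open U -> measurable U.
Proof.
move=> oU.
pose box (p : 'rV[rat]_n * nat) : set 'rV[R]_n :=
  [set y | forall i, `]ratr (p.1 ord0 i) - p.2.+1%:R^-1, ratr (p.1 ord0 i) + p.2.+1%:R^-1[%classic (y ord0 i)].
pose F k := if unpickle k is Some p then
  (if `[< box p `<=` U >] then box p else set0) else set0.
suff -> : U = \bigcup_k F k.
  apply: bigcupT_measurable => k; rewrite /F; case: unpickle => // p.
  by case: ifP => // _; apply: (@measurable_box (fun i => `]ratr (p.1 ord0 i) - p.2.+1%:R^-1, ratr (p.1 ord0 i) + p.2.+1%:R^-1[%classic)) => i; exact: measurable_itv.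
apply/seteqP; split => [x Ux|x [k _]]; last first.
  by rewrite /F; case: unpickle => // p; case: ifP => // /asboolP; exact.
have /nbhs_rVP[e e0 eU] : nbhs x U by exact: open_nbhs_nbhs.
have [m me] : exists m : nat, m.+1%:R^-1 < e / 2.
  have := @near_infty_natSinv_lt R (PosNum (divr_gt0 e0 (ltr0n _ 2))).
  by case=> m _ /(_ m (leqnn m)) /= H; exists m.
have m0 : 0 < m.+1%:R^-1 :> R by rewrite invr_gt0.
have qx i : exists q : rat, x ord0 i - m.+1%:R^-1 < ratr q < x ord0 i + m.+1%:R^-1.
  have := @rat_in_itvoo R (x ord0 i - m.+1%:R^-1) (x ord0 i + m.+1%:R^-1).
  case; first by rewrite ltrBlDr -addrA ltrDl addr_gt0.
  by move=> q; rewrite in_itv /=; exists q.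
have [q qP] := choice qx.
pose p := (\row_i q i, m); exists (pickle p) => //.
rewrite /F pickleK asboolT /box /=; last first.
  move=> y yp; apply: eU => i; have := yp i; have := qP i.
  rewrite /= mxE in_itv/= => /andP[q1 q2] /andP[y1 y2].
  rewrite ltr_norml; move: q1 q2 y1 y2 me.
  by set u := x _ _; set v := y _ _; set w := ratr _; set z := _%:R^-1; move=> *; lra.
move=> i; rewrite /= mxE in_itv /=; have := qP i.
by set u := x _ _; set w := ratr _; set z := _%:R^-1; move=> ?; lra.
Qed.

Lemma continuous_measurable_rV (f : 'rV[R]_n -> R) :
  continuous f -> measurable_fun setT f.
Proof.
move=> /continuousP cf _; apply: (measurability _ (RGenOpens.measurableE R)) => //.
move=> _ [_ [a [b ->] <-]]; rewrite setTI; apply: open_measurable_rV.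
exact/cf/interval_open.
Qed.

End Measurability.

Section Fubini.
Context {R : realType} {n : nat}.
Notation mu := (@lebesgue_measure R).

Local Open Scope ereal_scope.

Lemma ge0_integral_pcons (f : 'rV[R]_n.+1 -> \bar R) :
  measurable_fun setT f -> (forall x, 0 <= f x) ->
  \int[lebesgue_rV R n.+1]_x f x =
  \int[mu]_y0 \int[lebesgue_rV R n]_y f (pcons y0 y).
Proof.
move=> mf f0.
transitivity (\int[(mu \x lebesgue_rV R n)]_p (f \o pcons2) p).
  by rewrite [LHS](ge0_integral_pushforward measurable_pcons2).
rewrite fubini_tonelli1//; last by move=> p; exact: f0.
by apply: measurableT_comp => //; exact: measurable_pcons2.
Qed.

Lemma integral_pcons (f : 'rV[R]_n.+1 -> \bar R) :
  (lebesgue_rV R n.+1).-integrable setT f ->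
  \int[lebesgue_rV R n.+1]_x f x =
  \int[mu]_y0 \int[lebesgue_rV R n]_y f (pcons y0 y) /\
  \int[lebesgue_rV R n.+1]_x f x =
  \int[lebesgue_rV R n]_y \int[mu]_y0 f (pcons y0 y).
Proof.
move=> /integrableP[mf intf].
have mf2 : measurable_fun setT (f \o pcons2).
  by apply: measurableT_comp => //; exact: measurable_pcons2.
have if2 : (mu \x lebesgue_rV R n).-integrable setT (f \o pcons2).
  apply/integrableP; split => //; apply: le_lt_trans intf.
  by rewrite [leRHS](ge0_integral_pushforward measurable_pcons2)//; exact: measurableT_comp.
have -> : \int[lebesgue_rV R n.+1]_x f x = \int[(mu \x lebesgue_rV R n)]_p (f \o pcons2) p.
  by rewrite [LHS](integral_pushforward measurable_pcons2).
by split; [rewrite -integral12_prod_meas1|rewrite -integral21_prod_meas1].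
Qed.

End Fubini.

Section Cubes.
Context {R : realType} {n : nat}.
Notation mun := (lebesgue_rV R n).
Implicit Types (f g : 'rV[R]_n -> R) (K U : set 'rV[R]_n) (M : R).

Definition cube (M : R) : set 'rV[R]_n :=
  [set x | forall i, `[- M, M]%classic (x ord0 i)].

Definition supported (M : R) f := forall (x : 'rV[R]_n) i, M < `|x ord0 i| -> f x = 0.

Lemma compact_cube M : compact (cube M).
Proof. by apply: (@rV_compact R n (fun=> `[- M, M]%classic)) => i; exact: segment_compact. Qed.

Lemma measurable_cube M : measurable (cube M).
Proof. by apply: (@measurable_box R n (fun=> `[- M, M]%classic)) => i; exact: measurable_itv. Qed.

Lemma cube_lty M : (mun (cube M) < +oo)%E.
Proof.
rewrite (lebesgue_rV_box (A := fun=> `[- M, M]%classic))//.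
rewrite ltey_eq; apply/orP; left.
elim/big_ind : _ => // [x y|i _]; first exact: fin_numM.
by rewrite lebesgue_measure_itv /=; case: ifP.
Qed.

Lemma closed_measurable_rV K : closed K -> measurable K.
Proof. by move/closed_openC/open_measurable_rV/measurableC; rewrite setCK. Qed.

Lemma compact_measurable_rV K : compact K -> measurable K.
Proof. by move/(compact_closed (@norm_hausdorff _ _))/closed_measurable_rV. Qed.

Lemma compact_sub_cube K : compact K -> exists M, K `<=` cube M.
Proof.
move=> /compact_bounded[M [_ MK]]; exists (M + 1) => x Kx i /=.
rewrite in_itv /= -ler_norml; apply: le_trans (MK (M + 1) _ x Kx).
  by rewrite /Num.norm /= mx_normrE; exact: (le_bigmax _ (fun ij => `|x ij.1 ij.2|) (ord0, i)).
by rewrite ltrDl.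
Qed.

Lemma continuous_compact_bounded f K : continuous f -> compact K ->
  [bounded f x | x in K].
Proof.
move=> cf cK.
have /compact_bounded[M [rM MK]] := continuous_compact (continuous_subspaceT cf) cK.
by exists M; split => // N MN x Kx; apply: MK => //; exists x.
Qed.

Lemma continuous_compact_integrable_rV f K : continuous f -> compact K ->
  mun.-integrable K (EFin \o f).
Proof.
move=> cf cK; have mK := compact_measurable_rV cK.
apply: measurable_bounded_integrable => //.
- have [M KM] := compact_sub_cube cK.
  by apply: le_lt_trans (cube_lty M); apply: le_measure; rewrite ?inE//; exact: measurable_cube.
- by apply: measurable_funTS; exact: continuous_measurable_rV.
- exact: continuous_compact_bounded.
Qed.

Lemma supported_patch M f : supported M f -> f = f \_ (cube M).
Proof.
move=> sf; apply/funext => x; rewrite patchE; case: ifPn => // /negP xM.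
have [i xi] : exists i, ~ `[- M, M]%classic (x ord0 i).
  by apply/existsNP => H; apply: xM; rewrite inE.
by apply: (sf x i); rewrite ltNge; apply/negP; rewrite ler_norml => H; apply: xi; rewrite /= in_itv.
Qed.

Lemma supported_integrable M f : continuous f -> supported M f ->
  mun.-integrable setT (EFin \o f).
Proof.
move=> cf sf; rewrite (supported_patch sf) -restrict_EFin.
apply: (iffLR (integrable_mkcond _ (measurable_cube M))).
exact: (continuous_compact_integrable_rV cf (@compact_cube M)).
Qed.

Lemma supportedM M f g : supported M f -> supported M (fun x => g x * f x).
Proof. by move=> sf x i /sf ->; rewrite mulr0. Qed.

Lemma supported_partial M f i : supported M f -> supported M (partial i f).
Proof.
move=> sf x j xj; rewrite /partial.
have : {near x, f =1 cst 0}.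
  have : nbhs x [set y : 'rV[R]_n | M < `|y ord0 j|].
    have cn : (fun y : 'rV[R]_n => `|y ord0 j|) @ x --> `|x ord0 j|.
      exact: (cvg_norm (@coord_continuous R 1 n ord0 j x)).
    exact: (cvgr_gt _ cn).
  by apply: filterS => y; exact: sf.
by move=> /near_eq_derive ->; rewrite derive_cst.
Qed.

Lemma loc_integrable_continuous f : continuous f -> loc_integrable f.
Proof.
move=> cf; split; first exact: continuous_measurable_rV.
by move=> K /(continuous_compact_integrable_rV cf)/integrableP[_].
Qed.

End Cubes.

(** * Integration by parts *)

Section IntegrationByParts.
Context {R : realType}.
Notation mu := (@lebesgue_measure R).

Lemma integral_derive_supported (g g' : R -> R) M :
  (forall r : R, is_derive (r : R) (1 : R) g (g' r)) -> continuous g' ->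
  (forall r, M < `|r| -> g r = 0) -> (forall r, M < `|r| -> g' r = 0) ->
  (\int[mu]_r (g' r)%:E = 0)%E.
Proof.
move=> dg cg' gM g'M; pose N := `|M| + 1.
have MN : M < N by rewrite (le_lt_trans (ler_norm M))// ltrDl.
have N0 : 0 < N by rewrite ltr_wpDl.
have E : (fun r => (g' r)%:E) = (fun r => (g' r)%:E) \_ `[- N, N]%classic.
  apply/funext => r; rewrite patchE; case: ifPn => // /negP rN.
  rewrite g'M//; apply: (lt_le_trans MN); rewrite leNgt; apply/negP => /ltW.
  by rewrite ler_norml => H; apply: rN; rewrite inE /= in_itv.
rewrite E -integral_mkcond (@continuous_FTC2 _ _ g).
- by rewrite !gM ?subee// ?normrN gtr0_norm.
- by rewrite (lt_trans _ N0)// oppr_lt0.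
- exact: continuous_subspaceT.
- have cg : continuous g.
    by move=> r; apply/differentiable_continuous/derivable1_diffP; case: (dg r).
  split.
  + by move=> r _; case: (dg r).
  + exact/cvg_at_right_filter/cg.
  + exact/cvg_at_left_filter/cg.
- by move=> r _; rewrite derive1E; case: (dg r).
Qed.

(** By Fubini's theorem one integrates along the variable of differentiation
    first, and the fundamental theorem of calculus gives 0. As the measure is an
    iterated product, the variable is split off by induction on the dimension. *)
Lemma integral_partial n i (F : 'rV[R]_n -> R) M :
  continuous F -> (forall x, derivable F x (delta_mx ord0 i)) ->
  continuous (partial i F) -> supported M F ->
  (\int[lebesgue_rV R n]_x (partial i F x)%:E = 0)%E.
Proof.
elim: n i F => [[]//|n IHn] i F cF dF cdF sF.
have sdF := supported_partial i sF.
have [E1 E2] := integral_pcons (supported_integrable cdF sdF).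
have [j ij|i0] := unliftP ord0 i.
  rewrite [LHS]E1 integral0_eq// => y0 _.
  have D y : partial j (F \o pcons y0) y = partial i F (pcons y0 y).
    by rewrite ij; have [] := partial_pcons F y0 y j.
  rewrite -(IHn j (F \o pcons y0)).
  - by apply: eq_integral => y _; rewrite D.
  - by move=> y; apply: continuous_comp; [exact: continuous_pcons|exact: cF].
  - move=> y; have [_] := partial_pcons F y0 y j; apply; rewrite -ij; exact: dF.
  - rewrite (_ : partial _ _ = partial i F \o pcons y0).
      by move=> y; apply: continuous_comp; [exact: continuous_pcons|exact: cdF].
    by apply/funext => y; rewrite D.
  - by move=> y k yk; apply: (sF _ (lift ord0 k)); rewrite pconsS.
rewrite [LHS]E2 integral0_eq// => y _.
apply: (@integral_derive_supported (fun r => F (pcons r y)) _ M).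
- by move=> r; apply: is_derive_pcons0; rewrite -i0; exact: derivableP.
- by move=> r; apply: (@continuous_comp _ _ _ (fun r => pcons r y) (partial i F)); [exact: continuous_pcons0|exact: cdF].
- by move=> r rM; apply: (sF _ ord0); rewrite pcons0.
- by move=> r rM; apply: (sdF _ ord0); rewrite pcons0.
Qed.

Lemma integration_by_parts_rV n i (u f : 'rV[R]_n -> R) M :
  continuous u -> (forall x, derivable u x (delta_mx ord0 i)) -> continuous (partial i u) ->
  continuous f -> (forall x, derivable f x (delta_mx ord0 i)) -> continuous (partial i f) ->
  supported M f ->
  \int[lebesgue_rV R n]_x (u x * partial i f x) =
  - \int[lebesgue_rV R n]_x (partial i u x * f x).
Proof.
move=> cu du cdu cf df cdf sf; apply/eqP; rewrite -addr_eq0; apply/eqP.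
have cM (g h : 'rV[R]_n -> R) : continuous g -> continuous h ->
    continuous (fun x => g x * h x).
  by move=> cg ch x; exact: (cvgM (cg x) (ch x)).
pose w : 'rV[R]_n -> R := fun x => u x * f x.
have D x : partial i w x = u x * partial i f x + partial i u x * f x.
  by rewrite /partial (deriveM (du x) (df x)); congr (_ + _); exact: mulrC.
have dw x : derivable w x (delta_mx ord0 i) by exact: (derivableM (du x) (df x)).
have cdw : continuous (partial i w).
  rewrite (_ : partial i w = fun x => u x * partial i f x + partial i u x * f x); last exact/funext.
  by move=> x; exact: (cvgD (cM _ _ cu cdf x) (cM _ _ cdu cf x)).
have sw : supported M w by exact: supportedM.
rewrite -RintegralD//; last 2 first.
- by apply: (@supported_integrable _ _ M); [exact: cM|exact/supportedM/supported_partial].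
- by apply: (@supported_integrable _ _ M); [exact: cM|exact: supportedM].
under eq_Rintegral do rewrite -D.
by rewrite /Rintegral (integral_partial (cM _ _ cu cf) dw cdw sw).
Qed.

End IntegrationByParts.

(** * Classical derivatives as weak derivatives *)

Section WeakDerivatives.
Context {R : realType} {n : nat}.
Implicit Types (f g : 'rV[R]_n -> R) (s t : seq 'I_n) (eta nu : multi n).

(** Derivatives in every order of the variables: repeated integration by parts
    removes the innermost derivative of the test function first, and so passes
    through lists that are not sorted. *)
Definition all_partials f :=
  forall s, ex_iter_partial s f /\ continuous (iter_partial s f).

Lemma iter_partial_rcons s i f :
  iter_partial (rcons s i) f = iter_partial s (partial i f).
Proof. by rewrite /iter_partial foldr_rcons. Qed.

Lemma ex_iter_partial_rcons s i f : ex_iter_partial (rcons s i) f ->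
  ex_iter_partial s (partial i f).
Proof.
elim: s => [//|j s IH] [exs dj]; split; first exact: IH.
by move: dj; rewrite iter_partial_rcons.
Qed.

Lemma all_partials_partial f i : all_partials f -> all_partials (partial i f).
Proof.
move=> Hf s; have [exf cf] := Hf (rcons s i); split.
  exact: ex_iter_partial_rcons.
by rewrite -iter_partial_rcons.
Qed.

Lemma test_function_all_partials f : test_function f -> all_partials f.
Proof.
move=> [Cf _] s; have le_refl : mle (mcount s) (mcount s) by apply/forallP.
have [? ->] := iter_partial_mderiv (Cf (mcount s)) le_refl.
by split => //; exact: (Cf _ _ le_refl).2.
Qed.

Lemma test_function_supported f : test_function f -> exists M, supported M f.
Proof.
move=> [_ /compact_sub_cube[M fM]]; exists M => x i xi; apply/eqP/negPn/negP => fx.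
have /(_ i) := fM _ (@subset_closure _ [set x | f x != 0] _ fx).
by rewrite /= in_itv/= -ler_norml leNgt xi.
Qed.

(** The list is reversed because the outermost derivative of one factor becomes
    the innermost derivative of the other. *)
Lemma integration_by_parts_iter nu g s f M : Cmulti nu g -> mle (mcount s) nu ->
  all_partials f -> supported M f ->
  \int[lebesgue_rV R n]_x (g x * iter_partial (rev s) f x) =
  (-1) ^+ size s * \int[lebesgue_rV R n]_x (iter_partial s g x * f x).
Proof.
move=> Cg; elim: s f => [|i s IH] f le_nu Hf sf; first by rewrite expr0 mul1r.
have [/= [_ dg] Eg] := iter_partial_mderiv Cg le_nu.
have [_ Eg'] := iter_partial_mderiv Cg (mle_mcountW le_nu).
rewrite rev_cons iter_partial_rcons (IH (partial i f)).
- have [[_ df] cdf] := Hf [:: i]; have [_ cf] := Hf [::].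
  have cg : continuous (iter_partial s g) by rewrite Eg'; exact: (Cg _ (mle_mcountW le_nu)).2.
  have cdg : continuous (partial i (iter_partial s g)).
    by rewrite Eg; exact: (Cg _ le_nu).2.
  rewrite (integration_by_parts_rV cg dg cdg cf df cdf sf).
  by rewrite [size _]/= exprS mulN1r mulrN mulNr.
- exact: mle_mcountW le_nu.
- exact: all_partials_partial.
- exact: supported_partial.
Qed.

Lemma is_weak_deriv_mderiv nu g eta : Cmulti nu g -> mle eta nu ->
  is_weak_deriv eta g (mderiv eta g).
Proof.
move=> Cg le_nu; split; first exact: loc_integrable_continuous (Cg _ le_nu).2.
move=> f tf; have [M sf] := test_function_supported tf.
have Er : mcount (rev (mseq eta)) = eta.
  by rewrite -[RHS]mcount_mseq; apply: mcount_perm; rewrite perm_rev.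
have le_eta : mle (mcount (rev (mseq eta))) eta by rewrite Er; apply/forallP.
have [_ E] := iter_partial_mderiv (tf.1 eta) le_eta.
rewrite Er in E.
rewrite -E (@integration_by_parts_iter nu g (mseq eta) f M)//.
- by rewrite (_ : mdeg eta = size (mseq eta))// -mdeg_mcount mcount_mseq.
- by rewrite mcount_mseq.
- exact: test_function_all_partials.
Qed.

End WeakDerivatives.

(** * Smooth bump functions *)

Section SmoothBumps.
Context {R : realType}.

(** The functions x^(-m) exp(-1/x), extended by 0 to the left. The family is
    closed under differentiation up to linear combinations, which makes the smoothness
    of exp(-1/x) an induction over the whole family. *)
Definition expinv (m : nat) (x : R) : R :=
  if 0 < x then x^-1 ^+ m * expR (- x^-1) else 0.

Lemma expinv_ge0 m x : 0 <= expinv m x.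
Proof.
rewrite /expinv; case: ifP => // x0.
by rewrite mulr_ge0 ?expR_ge0// exprn_ge0// invr_ge0 ltW.
Qed.

Lemma expinv0_gt0 x : 0 < x -> 0 < expinv 0 x.
Proof. by move=> x0; rewrite /expinv x0 expr0 mul1r expR_gt0. Qed.

Lemma expinv_eq0 m x : x <= 0 -> expinv m x = 0.
Proof. by rewrite /expinv ltNge => ->. Qed.

(** One term of the exponential series, exp u >= u^(m+1) / (m+1)! at u = 1/x, gives
    the flatness at 0 that the derivative there needs. *)
Lemma expinv_le m x : expinv m x <= (m.+1)`!%:R * `|x|.
Proof.
rewrite /expinv; case: ifPn => [x0|_]; last by rewrite mulr_ge0.
have u0 : 0 < x^-1 by rewrite invr_gt0.
rewrite expRN ler_pdivrMr ?expR_gt0// gtr0_norm//.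
have := expR_ge1Dxn m (ltW u0); set E := expR _ => H.
have {}H : x^-1 ^+ m.+1 / (m.+1)`!%:R <= E by rewrite (le_trans _ H)// lerDr.
rewrite ler_pdivrMr ?ltr0n ?fact_gt0// in H.
rewrite -(ler_pM2l u0) -exprS (le_trans H)//.
by rewrite [leRHS]mulrA mulrCA mulVf ?mulr1 ?gt_eqF// mulrC.
Qed.

Lemma expinv0_le1 x : expinv 0 x <= 1.
Proof.
rewrite /expinv; case: ifPn => // x0.
by rewrite expr0 mul1r expR_le1 oppr_le0 invr_ge0 ltW.
Qed.

Lemma is_derive_expinv m (x : R) : is_derive x (1 : R) (expinv m)
  (- m%:R * expinv m.+1 x + expinv m.+2 x).
Proof.
have [x0|x0|->] := ltgtP x 0.
- apply: (@near_eq_is_derive _ _ _ (cst 0)).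
    near=> y; rewrite /expinv /= ifN// -leNgt ltW//.
    by near: y; exact: lt_nbhsl.
  rewrite /expinv ltNge (ltW x0)/= mulr0 addr0; exact: is_derive_cst.
- have xn0 : x != 0 by rewrite gt_eqF.
  pose h (u : R) := u ^+ m * expR (- u).
  apply: (@near_eq_is_derive _ _ _ (h \o (fun y => y^-1))).
    near=> y; rewrite /expinv /h /= ifT//.
    by near: y; exact: lt_nbhsr.
  have dV : is_derive x (1 : R) (fun y : R => y^-1) (- x ^- 2 *: 1) by exact: is_deriveV.
  have dh (u : R) : is_derive u (1 : R) h
      (m%:R * u ^+ m.-1 * expR (- u) - u ^+ m * expR (- u)).
    have d1 : is_derive u (1 : R) (fun u : R => expR (- u)) (expR (- u) * (- 1)).
      have := @is_derive1_comp R expR -%R u (expR (- u)) (- 1); apply.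
    have d0 : is_derive u (1 : R) (fun u : R => u ^+ m) (m%:R * u ^+ m.-1).
      have := @is_deriveX R R id m u 1 1 (is_derive_id _ _).
      rewrite [_ *: 1]mulr1 (_ : id ^+ m = fun u : R => u ^+ m)//.
      by apply/funext => y; rewrite exprfctE.
    have H : is_derive u (1 : R) h (u ^+ m *: (expR (- u) * -1)
        + expR (- u) *: (m%:R * u ^+ m.-1)) by exact: (is_deriveM d0 d1).
    apply: (is_derive_eq H).
    by rewrite mulrN1 /GRing.scale /=; ring.
  rewrite [_ + _](_ : _ = (m%:R * x^-1 ^+ m.-1 * expR (- x^-1) - x^-1 ^+ m * expR (- x^-1)) * (- x ^- 2 *: 1)).
    exact: is_derive1_comp.
  rewrite /expinv x0 [_ *: 1]mulr1 -exprVn.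
  case: (m) => [|k]; first by rewrite !mul0r oppr0 mul0r; ring.
  by rewrite /= !exprS; ring.
- apply/is_derive_epsP => e e0.
  have C0 : 0 < (m.+2)`!%:R :> R by rewrite ltr0n fact_gt0.
  exists (e / (m.+2)`!%:R); first by rewrite divr_gt0.
  move=> h hd; rewrite [h *: 1]mulr1 addr0 /expinv ltxx /= mulr0 addr0 mulr0 !subr0.
  rewrite -/(expinv m h).
  (* The difference quotient at 0 is again a member of the family. *)
  have -> : expinv m h = h * expinv m.+1 h.
    rewrite /expinv; case: ifPn => [h0|_]; last by rewrite mulr0.
    by rewrite exprS !mulrA divff ?gt_eqF// mul1r.
  rewrite normrM mulrC ler_wpM2r// ger0_norm ?expinv_ge0//.
  apply: le_trans (expinv_le _ _) _.
  by rewrite mulrC -ler_pdivlMr// ltW.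
Unshelve. all: by end_near. Qed.

Lemma continuous_expinv m : continuous (expinv m).
Proof.
move=> x; apply/differentiable_continuous/derivable1_diffP.
by case: (is_derive_expinv m x).
Qed.

End SmoothBumps.

Section Smooth.
Context {R : realType} {n : nat}.
Implicit Types (f g : 'rV[R]_n -> R).

Lemma continuousD_rV f g : continuous f -> continuous g ->
  continuous (fun x => f x + g x).
Proof. by move=> cf cg x; exact: (cvgD (cf x) (cg x)). Qed.

Lemma continuousM_rV f g : continuous f -> continuous g ->
  continuous (fun x => f x * g x).
Proof. by move=> cf cg x; exact: (cvgM (cf x) (cg x)). Qed.

(** Functions of class C^k, by recursion over one partial derivative at a time:
    in this form stability under sums and products is a plain induction on k. *)
Fixpoint smooth (k : nat) f : Prop := continuous f /\
  if k is k'.+1 then forall i, (forall x, derivable f x (delta_mx ord0 i)) /\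
    smooth k' (partial i f) else True.

Lemma smooth_continuous k f : smooth k f -> continuous f.
Proof. by case: k => [|k] []. Qed.

Lemma smoothW k f : smooth k.+1 f -> smooth k f.
Proof.
elim: k f => [|k IH] f; first by case.
move=> [cf Hf]; split => // i; have [df Sf] := Hf i.
by split => //; exact: IH.
Qed.

Lemma smooth_cst k (c : R) : smooth k (fun=> c).
Proof.
elim: k c => [|k IH] c; (split; first exact: cst_continuous); first by [].
move=> i; split; first by move=> x; exact: (@derivable_cst _ _ _ c x).
rewrite (_ : partial i _ = fun=> 0); first exact: IH.
by apply/funext => x; exact: derive_cst.
Qed.

Lemma smoothD k f g : smooth k f -> smooth k g -> smooth k (fun x => f x + g x).
Proof.
elim: k f g => [|k IH] f g Sf Sg; (split; first exact: continuousD_rV (smooth_continuous Sf) (smooth_continuous Sg)); first by [].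
move=> i; have [df Sdf] := Sf.2 i; have [dg Sdg] := Sg.2 i.
split; first by move=> x; exact: (derivableD (df x) (dg x)).
rewrite (_ : partial i _ = fun x => partial i f x + partial i g x); first exact: IH.
by apply/funext => x; exact: (deriveD (df x) (dg x)).
Qed.

Lemma smoothM k f g : smooth k f -> smooth k g -> smooth k (fun x => f x * g x).
Proof.
elim: k f g => [|k IH] f g Sf Sg; (split; first exact: continuousM_rV (smooth_continuous Sf) (smooth_continuous Sg)); first by [].
move=> i; have [df Sdf] := Sf.2 i; have [dg Sdg] := Sg.2 i.
split; first by move=> x; exact: (derivableM (df x) (dg x)).
rewrite (_ : partial i _ = fun x => f x * partial i g x + g x * partial i f x).
  by apply: smoothD; apply: IH => //; exact: smoothW.
by apply/funext => x; exact: (deriveM (df x) (dg x)).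
Qed.

Lemma smoothX k f m : smooth k f -> smooth k (fun x => f x ^+ m).
Proof.
move=> Sf; elim: m => [|m IH]; first exact: smooth_cst.
by under eq_fun do rewrite exprS; exact: smoothM.
Qed.

Lemma smooth_prod k (I : Type) (r : seq I) (F : I -> 'rV[R]_n -> R) :
  (forall i, smooth k (F i)) -> smooth k (fun x => \prod_(i <- r) F i x).
Proof.
move=> SF; elim: r => [|i r IH]; first by under eq_fun do rewrite big_nil; exact: smooth_cst.
by under eq_fun do rewrite big_cons; exact: smoothM.
Qed.

Lemma smooth_expinv k m (s c : R) j :
  smooth k (fun x => expinv m (s * x ord0 j + c)).
Proof.
have cl : continuous (fun x : 'rV[R]_n => s * x ord0 j + c).
  apply: continuousD_rV; last exact: cst_continuous.
  apply: continuousM_rV; first exact: cst_continuous.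
  exact: coord_continuous.
have cm m' : continuous (fun x : 'rV[R]_n => expinv m' (s * x ord0 j + c)).
  by move=> x; exact: (continuous_comp (cl x) (@continuous_expinv R m' _)).
elim: k m => [|k IH] m; (split; first exact: cm); first by [].
move=> i.
have dE x : is_derive x (delta_mx ord0 i) (fun x : 'rV[R]_n => expinv m (s * x ord0 j + c))
    ((s * (j == i)%:R) * (- m%:R * expinv m.+1 (s * x ord0 j + c)
      + 1 * expinv m.+2 (s * x ord0 j + c))).
  apply: is_derive_of_line; rewrite mul1r.
  pose l (r : R) := s * (r *: delta_mx ord0 i + x : 'rV[R]_n) ord0 j + c.
  have dl : is_derive (0 : R) (1 : R) l (s * (j == i)%:R).
    apply/is_derive_epsP => e e0; exists 1 => // h _.
    rewrite (_ : _ - _ = 0) ?normr0 ?mulr_ge0 ?(ltW e0)//.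
    by rewrite addr0 [h *: 1]mulr1 /l !mxE eqxx /=; ring.
  have E0 : l 0 = s * x ord0 j + c by rewrite /l scale0r add0r.
  rewrite -E0 mulrC; exact: (is_derive1_comp (is_derive_expinv m (l 0)) dl).
split; first by move=> x; case: (dE x).
rewrite (_ : partial i _ = fun x => (s * (j == i)%:R) *
    (- m%:R * expinv m.+1 (s * x ord0 j + c) + 1 * expinv m.+2 (s * x ord0 j + c))).
  apply: smoothM; first exact: smooth_cst.
  by apply: smoothD; apply: smoothM; (exact: smooth_cst || exact: IH).
by apply/funext => x; case: (dE x).
Qed.

Lemma smooth_iter_partial k s f : smooth (k + size s) f ->
  ex_iter_partial s f /\ smooth k (iter_partial s f).
Proof.
elim: s k => [|i s IH] k /=; first by rewrite addn0.
rewrite addnS -addSn => /IH[exf [_ Hf]]; have [df Sf] := Hf i.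
by split.
Qed.

Lemma test_function_smooth f M : (forall k, smooth k f) -> supported M f ->
  test_function f.
Proof.
move=> Sf sf; split.
  move=> nu eta _; have [exf cf] := @smooth_iter_partial 0 (mseq eta) f (Sf _).
  by split => //; exact: smooth_continuous cf.
apply: (subclosed_compact _ (@compact_cube R n M)); first exact: closed_closure.
have clC : closed (@cube R n M).
  by apply: compact_closed; [exact: norm_hausdorff|exact: compact_cube].
rewrite [X in _ `<=` X](closure_id _).1//; apply: closureS => x fx i /=.
rewrite in_itv/= -ler_norml leNgt; apply/negP => xi.
by move: fx; rewrite /= (sf _ _ xi) eqxx.
Qed.

End Smooth.

(** * The du Bois-Reymond lemma and uniqueness of weak derivatives *)

Section DuBoisReymond.
Context {R : realType} {n : nat}.
Notation mun := (lebesgue_rV R n).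
Implicit Types (f g w : 'rV[R]_n -> R) (a : 'rV[R]_n) (N : R).

Definition corner_box a N : set 'rV[R]_n :=
  [set x | forall i, `]a ord0 i, N[%classic (x ord0 i)].

Lemma measurable_corner_box a N : measurable (corner_box a N).
Proof. by apply: (@measurable_box R n (fun i => `]a ord0 i, N[%classic)) => i; exact: measurable_itv. Qed.

Definition bump a N (x : 'rV[R]_n) : R :=
  \prod_i (expinv 0 (1 * x ord0 i + - a ord0 i) * expinv 0 (- 1 * x ord0 i + N)).

(** The function 1 - (1 - bump)^k. As the bump lies in (0, 1] inside the box and is 0
    outside, these are test functions that converge to the indicator function of the
    box. The coefficients - 1 are written out so that the function is literally built
    from sums, products and constants. *)
Definition bump_approx a N (k : nat) (x : 'rV[R]_n) : R :=
  1 + - 1 * (1 + - 1 * bump a N x) ^+ k.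

Lemma smooth_bump_approx a N k m : smooth m (bump_approx a N k).
Proof.
have sc c : @smooth R n m (fun=> c) by exact: smooth_cst.
apply: smoothD => //; apply: smoothM => //; apply: smoothX.
apply: smoothD => //; apply: smoothM => //.
by apply: smooth_prod => i; apply: smoothM; exact: smooth_expinv.
Qed.

Lemma bump01 a N x : 0 <= bump a N x <= 1.
Proof.
rewrite /bump; elim/big_ind : _ => [|u v|i _]; first by rewrite ler01 lexx.
  by move=> /andP[u0 u1] /andP[v0 v1]; rewrite mulr_ge0// mulr_ile1.
by rewrite mulr_ge0 ?expinv_ge0// mulr_ile1 ?expinv_ge0 ?expinv0_le1.
Qed.

Lemma bump_gt0 a N x : corner_box a N x -> 0 < bump a N x.
Proof.
move=> xb; apply: prodr_gt0 => i _; have := xb i; rewrite /= in_itv/= => /andP[ax xN].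
by rewrite mulr_gt0// expinv0_gt0// ?mul1r ?subr_gt0// mulN1r addrC subr_gt0.
Qed.

Lemma bump_eq0 a N x : ~ corner_box a N x -> bump a N x = 0.
Proof.
move=> /existsNP[i xi]; rewrite /bump (bigD1 i)//= mul1r mulN1r.
have [ax|ax] := ltP (a ord0 i) (x ord0 i); last first.
  by rewrite expinv_eq0 ?mul0r// subr_le0.
have [xN|xN] := ltP (x ord0 i) N; last first.
  by rewrite (@expinv_eq0 _ _ (- _ + _)) ?mulr0 ?mul0r// addrC subr_le0.
by exfalso; apply: xi; rewrite /= in_itv/= ax xN.
Qed.

Lemma bump_approx_eq0 a N k x : ~ corner_box a N x -> bump_approx a N k x = 0.
Proof. by move=> /bump_eq0 b0; rewrite /bump_approx b0 mulr0 addr0 expr1n; ring. Qed.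

Lemma bump_approx01 a N k x : 0 <= bump_approx a N k x <= 1.
Proof.
have /andP[b0 b1] := bump01 a N x; rewrite /bump_approx !mulN1r.
have c0 : 0 <= 1 - bump a N x by rewrite subr_ge0.
have c1 : 1 - bump a N x <= 1 by rewrite gerBl.
by rewrite subr_ge0 exprn_ile1//= gerBl exprn_ge0.
Qed.

Lemma cvg_bump_approx a N x :
  bump_approx a N k x @[k --> \oo] --> (\1_(corner_box a N) x : R).
Proof.
rewrite indicE; have [xb|xb] := pselect (corner_box a N x); last first.
  rewrite memNset//=; under eq_fun do rewrite bump_approx_eq0//.
  exact: cvg_cst.
rewrite mem_set//= /bump_approx -[X in _ --> X]addr0.
apply: cvgD; first exact: cvg_cst.
rewrite -[X in _ --> X](mulr0 (- 1)); apply: cvgM; first exact: cvg_cst.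
have /andP[b0 b1] := bump01 a N x; have b0' := bump_gt0 xb.
by apply: cvg_expr; rewrite mulN1r ger0_norm ?subr_ge0// gtrBl.
Qed.

Lemma corner_box_sub_cube a N : (forall i, - N <= a ord0 i) ->
  corner_box a N `<=` cube N.
Proof.
move=> aN x xb i; have := xb i; rewrite /= !in_itv/= => /andP[ax /ltW ->].
by rewrite andbT (le_trans (aN i))// ltW.
Qed.

Lemma test_function_bump_approx a N k : (forall i, - N <= a ord0 i) ->
  test_function (bump_approx a N k).
Proof.
move=> aN; apply: (@test_function_smooth R n _ N); first by move=> m; exact: smooth_bump_approx.
move=> x i xi; apply: bump_approx_eq0 => /(corner_box_sub_cube aN)/(_ i).
by rewrite /= in_itv /= -ler_norml leNgt xi.
Qed.

Local Open Scope ereal_scope.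

(** Dominated convergence along test functions tending to the indicator function
    of the box. *)
Lemma integral_corner_box w a N : loc_integrable w ->
  (forall f, test_function f -> \int[mun]_x (w x * f x)%:E = 0) ->
  (forall i, (- N <= a ord0 i)%R) ->
  \int[mun]_(x in corner_box a N) (w x)%:E = 0.
Proof.
move=> [mw lw] wf aN; have cbC := corner_box_sub_cube aN.
have mC := @measurable_cube R n N.
have iw : mun.-integrable (cube N) (EFin \o w).
  apply/integrableP; split; first by apply/measurable_EFinP; exact: measurable_funTS.
  exact: lw (@compact_cube R n N).
pose f_ k (x : 'rV[R]_n) := (w x * bump_approx a N k x)%:E.
pose f (x : 'rV[R]_n) := (w x * \1_(corner_box a N) x)%:E.
have mb k : measurable_fun setT (bump_approx a N k).
  by apply: continuous_measurable_rV; exact: smooth_continuous (smooth_bump_approx a N k 0).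
have [|||//||_ _] := @dominated_convergence _ _ R mun (cube N) mC f_ f (abse \o (EFin \o w)).
- move=> k; apply/measurable_EFinP; apply: measurable_funTS.
  by apply: measurable_funM.
- apply/measurable_EFinP; apply: measurable_funTS; apply: measurable_funM => //.
  by apply: measurable_indic; exact: measurable_corner_box.
- apply: aeW => x _; apply: cvg_EFin; first by apply: nearW.
  apply: cvgM; [exact: cvg_cst|exact: cvg_bump_approx].
- exact: integrable_abse.
- apply: aeW => x k _; rewrite /f_ /= lee_fin normrM.
  have /andP[c0 c1] := bump_approx01 a N k x.
  by rewrite (ger0_norm c0) ler_piMr.
rewrite (_ : (fun k => _) = cst 0); last first.
  apply/funext => k; rewrite -[RHS](wf _ (test_function_bump_approx k aN)).
  rewrite integral_mkcond; apply: eq_integral => x _; rewrite patchE; case: ifPn => // /negP xN.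
  by rewrite bump_approx_eq0 ?mulr0// => /cbC; rewrite -in_setE.
move=> /(cvg_unique (@ereal_hausdorff R) (cvg_cst _)) H.
have -> : \int[mun]_(x in corner_box a N) (w x)%:E = \int[mun]_(x in cube N) f x.
  rewrite integral_mkcond [RHS]integral_mkcond; apply: eq_integral => x _.
  rewrite /f !patchE indicE; case: ifPn => [xb|_].
    by rewrite mem_set ?mulr1//; apply: cbC; rewrite inE in xb.
  by rewrite mulr0; case: ifP.
by rewrite -H.
Qed.

Definition corner a : set 'rV[R]_n :=
  [set x | forall i, `]a ord0 i, +oo[%classic (x ord0 i)].

(** Corners are stable under intersection, so they form a generating pi-system to
    which the pi-lambda theorem applies. *)
Lemma measurable_rV_corners :
  @measurable _ 'rV[R]_n = <<s range corner >>.
Proof.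
apply/seteqP; split; last first.
  apply: smallest_sub; first exact: sigma_algebra_measurable.
  move=> _ [a _ <-]; apply: (@measurable_box R n (fun i => `]a ord0 i, +oo[%classic)) => i.
  exact: measurable_itv.
apply: smallest_sub; first exact: smallest_sigma_algebra.
rewrite -bigcup_seq /=; apply: bigcup_sub => i _ A [B mB <-].
suff /(_ measurableT _ mB) : measurable_fun [set: g_sigma_algebraType (range corner)]
  (Defs.coord i) by [].
apply: (measurability _ (RGenOInfty.measurableE R)) => //.
move=> _ [_ [c ->] <-]; rewrite setTI.
(* A half-space is the union of the corners whose other sides recede to -oo. *)
pose b (k : nat) : 'rV[R]_n := (\row_j if j == i then c else - k%:R)%R.
rewrite (_ : _ @^-1` _ = \bigcup_k corner (b k)).
  by apply: bigcupT_measurable => k; apply: sub_sigma_algebra; exists (b k).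
apply/seteqP; split => [x /=|x [k _ /(_ i)]]; last by rewrite /= mxE eqxx.
rewrite in_itv/= andbT /Defs.coord => cx.
pose K := (\max_(j < n) Num.bound (x ord0 j))%N; exists K => // j /=.
rewrite in_itv/= andbT mxE; case: eqP => [->//|_].
rewrite ltrNl (le_lt_trans (ler_norm _))// normrN.
apply: (lt_le_trans (archi_boundP (normr_ge0 _))).
rewrite ler_nat; apply: leq_trans (leq_bigmax j).
by rewrite /Num.bound normr_id.
Qed.

(** The integral of w vanishes over boxes, which are limits of test functions,
    hence by the pi-lambda theorem over every Borel subset of a cube, and a function
    whose integral over all Borel sets vanishes is 0 almost everywhere. The cubes
    exhaust the space. *)
Lemma du_bois_reymond w : loc_integrable w ->
  (forall f, test_function f -> \int[mun]_x (w x * f x)%:E = 0) ->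
  {ae mun, forall x, w x = 0%R}.
Proof.
move=> lw wf.
pose Q (k : nat) := corner_box (\row_(j < n) (- k%:R))%R k%:R.
have mQ k : measurable (Q k) by exact: measurable_corner_box.
have iw k : mun.-integrable (Q k) (EFin \o w).
  apply: (@integrableS _ _ _ _ (@cube R n k%:R)) => //; first exact: measurable_cube.
    by apply: corner_box_sub_cube => i; rewrite mxE.
  case: lw => mw lw; apply/integrableP; split; last exact: lw (@compact_cube R n _).
  by apply/measurable_EFinP; exact: measurable_funTS.
have iwI k A : measurable A -> mun.-integrable (A `&` Q k) (EFin \o w).
  by move=> mA; apply: integrableS (iw k) => //; exact: measurableI.
have Z k A : measurable A -> \int[mun]_(x in A `&` Q k) (w x)%:E = 0.
  rewrite measurable_rV_corners; move: A.
  have PT : \int[mun]_(x in Q k) (w x)%:E = 0.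
    by apply: integral_corner_box => // i; rewrite mxE.
  apply: (dynkin_induction measurable_rV_corners).
  - move=> _ _ [a _ <-] [b _ <-].
    exists (\row_i Num.max (a ord0 i) (b ord0 i))%R => //.
    apply/seteqP; split => [x xm|x [xa xb] i].
      by split=> i; have := xm i; rewrite /= mxE !in_itv/= !andbT gt_max => /andP[].
    by have := xa i; have := xb i; rewrite /= mxE !in_itv/= !andbT gt_max => -> ->.
  - by rewrite setTI.
  - move=> _ [a _ <-].
    rewrite (_ : _ `&` _ = corner_box (\row_i Num.max (a ord0 i) (- k%:R))%R k%:R).
      by apply: integral_corner_box => // i; rewrite mxE le_max lexx orbT.
    apply/seteqP; split => [x [xa xQ] i|x xm].
      have := xa i; have := xQ i; rewrite /= !mxE !in_itv/= !andbT gt_max.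
      by move=> /andP[-> ->] ->.
    split=> i; have := xm i; rewrite /= !mxE !in_itv/= gt_max => /andP[/andP[c1 c2] c3]; rewrite ?c1 ?c2 ?c3//.
  - move=> S mS PS.
    have : \int[mun]_(x in (S `&` Q k) `|` (~` S `&` Q k)) (w x)%:E = 0.
      by rewrite -setIUl setUv setTI.
    rewrite integral_setU //.
    + by rewrite PS add0e.
    + exact: measurableI.
    + by apply: measurableI => //; exact: measurableC.
    + by rewrite -setIUl setUv setTI; exact: measurable_int (iw k).
    + by apply/disj_setPS => x [[? _] []].
  - move=> F mF tF PF; rewrite setI_bigcupl integral_bigcup.
    + by apply: eseries0 => i _ _; exact: PF.
    + apply/trivIsetP => i j _ _ ij.
      rewrite setIACA setIid; move/trivIsetP : tF => /(_ i j Logic.I Logic.I ij) ->.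
      by rewrite set0I.
    + by move=> i; exact: measurableI.
    + by rewrite -setI_bigcupl; apply: iwI; exact: bigcupT_measurable.
have aeQ k : ae_eq mun (Q k) (EFin \o w) (cst 0).
  apply: integral_ae_eq => // E EQ mE.
  have EI : E `&` Q k = E by apply/seteqP; split => [x []//|x Ex]; split => //; exact: EQ.
  by rewrite integral0 -(Z k E mE) EI.
have : mun.-negligible (\bigcup_k ~` [set x | Q k x -> (EFin \o w) x = cst 0 x]).
  by apply: negligible_bigcup => k; exact: aeQ.
apply: negligibleS => x /= wx.
pose K := (\max_(j < n) Num.bound (x ord0 j))%N; exists K => //= H.
apply: wx; have /H[//] : Q K x.
move=> j; rewrite /= mxE in_itv/= -ltr_norml.
apply: (lt_le_trans (archi_boundP (normr_ge0 _))).
by rewrite ler_nat; apply: leq_trans (leq_bigmax j); rewrite /Num.bound normr_id.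
Qed.

Lemma loc_integrable_test w f : loc_integrable w -> test_function f ->
  mun.-integrable setT (fun x => (w x * f x)%:E).
Proof.
move=> [mw lw] tf; have [M sf] := test_function_supported tf.
have cf : continuous f by have [_] := test_function_all_partials tf [::].
have -> : (fun x => (w x * f x)%:E) = ((fun x => (w x * f x)%:E) \_ (cube M)).
  apply/funext => x; rewrite patchE; case: ifPn => // /negP xM.
  by rewrite (supported_patch sf) patchE ifN ?mulr0//; apply/negP.
apply: (iffLR (integrable_mkcond _ (@measurable_cube R n M))).
apply: (@integrableMl _ _ _ mun (cube M) _ (EFin \o w) f).
- exact: measurable_cube.
- apply/integrableP; split; last exact: lw (@compact_cube R n _).
  by apply/measurable_EFinP; exact: measurable_funTS.
- by apply: measurable_funTS; exact: continuous_measurable_rV.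
- exact: continuous_compact_bounded (@compact_cube R n M).
Qed.

Lemma loc_integrableB v w : loc_integrable v -> loc_integrable w ->
  loc_integrable (fun x => v x - w x)%R.
Proof.
move=> [mv lv] [mw lw]; split; first exact: measurable_funB.
move=> K cK; have mK := compact_measurable_rV cK.
have iv : mun.-integrable K (EFin \o v).
  by apply/integrableP; split; [apply/measurable_EFinP; exact: measurable_funTS|exact: lv].
have iw : mun.-integrable K (EFin \o w).
  by apply/integrableP; split; [apply/measurable_EFinP; exact: measurable_funTS|exact: lw].
by have /integrableP[_] := integrableB mK iv iw.
Qed.

Lemma weak_deriv_unique eta g v w : is_weak_deriv eta g v -> is_weak_deriv eta g w ->
  {ae mun, forall x, v x = w x}.
Proof.
move=> [lv Hv] [lw Hw].
have := @du_bois_reymond (fun x => v x - w x)%R (loc_integrableB lv lw).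
have H f : test_function f -> \int[mun]_x ((v x - w x) * f x)%:E = 0.
  move=> tf; have iv := loc_integrable_test lv tf; have iw := loc_integrable_test lw tf.
  under eq_integral do rewrite mulrBl EFinB.
  rewrite integralB_EFin//.
  have : (\int[mun]_x (v x * f x) = \int[mun]_x (w x * f x))%R.
    have := Hv f tf; rewrite (Hw f tf) => /(congr1 (fun z => (-1) ^+ mdeg eta * z)%R).
    by rewrite !mulrA -expr2 sqrr_sign !mul1r.
  rewrite /Rintegral => E.
  rewrite -(fineK (integrable_fin_num measurableT iv)) -(fineK (integrable_fin_num measurableT iw)).
  by rewrite E subee.
move=> /(_ H); apply: filterS => x /eqP; rewrite subr_eq0 => /eqP; exact.
Qed.

(** Whichever version of the weak derivative is chosen, it agrees almost everywhere
    with the classical one, by uniqueness. This is what transfers bounds on classical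
    derivatives to the norm. *)
Lemma weak_deriv_mderiv nu g eta : Cmulti nu g -> mle eta nu ->
  is_weak_deriv eta g (weak_deriv eta g) /\
  {ae mun, forall x, weak_deriv eta g x = mderiv eta g x}.
Proof.
move=> Cg le_nu; have wg := is_weak_deriv_mderiv Cg le_nu.
have wg' : is_weak_deriv eta g (weak_deriv eta g) by exact: (xgetPex _ (ex_intro _ _ wg)).
by split => //; exact: weak_deriv_unique wg' wg.
Qed.

End DuBoisReymond.

(** * The implicit function xi *)

Lemma quotient_near (R : realType) (A C e : R) : 0 < C -> 0 < e ->
  exists2 eta, 0 < eta & forall A' C', `|A' - A| <= eta -> `|C' - C| <= eta ->
    0 < C' /\ `|A' / C' - A / C| <= e.
Proof.
move=> C0 e0; have AC0 : 0 < `|A| + C by rewrite ltr_wpDl.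
exists (Num.min (C / 2) (e * C ^+ 2 / 2 / (`|A| + C))).
  by rewrite lt_min !divr_gt0// mulr_gt0// exprn_gt0.
move=> A' C'; rewrite !le_min => /andP[_ A1] /andP[C2 C1].
have C'0 : C / 2 <= C' by move: C2; rewrite ler_norml => /andP[+ _]; lra.
have C'gt0 : 0 < C' by apply: lt_le_trans C'0; rewrite divr_gt0.
split=> //.
have -> : A' / C' - A / C = (C * (A' - A) - A * (C' - C)) / (C * C').
  by field; rewrite !lt0r_neq0.
rewrite normrM normfV (gtr0_norm (mulr_gt0 C0 C'gt0)) ler_pdivrMr ?mulr_gt0//.
apply: le_trans (ler_normB _ _) _; rewrite !normrM (gtr0_norm C0).
rewrite (@le_trans _ _ (e * C ^+ 2 / 2))//; last first.
  by rewrite -mulrA ler_wpM2l ?(ltW e0)// expr2 -mulrA ler_wpM2l// ltW.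
rewrite [leRHS](_ : _ = (C + `|A|) * (e * C ^+ 2 / 2 / (`|A| + C))); last first.
  by field; rewrite lt0r_neq0.
by rewrite mulrDl lerD// ler_wpM2l// ltW.
Qed.

Section ContinuousAt.
Context {R : realType} {T : topologicalType}.
Implicit Types (f g : T -> R) (x : T).

Lemma continuous_atM f g x : {for x, continuous f} -> {for x, continuous g} ->
  {for x, continuous (fun z => f z * g z)}.
Proof. by move=> cf cg; apply: cvgM; [exact: cf|exact: cg]. Qed.

Lemma continuous_atN f x : {for x, continuous f} -> {for x, continuous (fun z => - f z)}.
Proof. by move=> cf; apply: cvgN; exact: cf. Qed.

Lemma continuous_atV f x : f x != 0 -> {for x, continuous f} ->
  {for x, continuous (fun z => (f z)^-1)}.
Proof. by move=> fx0 cf; apply: cvgV; [exact: fx0|exact: cf]. Qed.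

Lemma continuous_at_comp (S W : topologicalType) (f : T -> S) (g : S -> W) x :
  {for x, continuous f} -> {for f x, continuous g} ->
  {for x, continuous (fun z => g (f z))}.
Proof. exact: continuous_comp. Qed.

Lemma continuous_at_prod (I : eqType) (r : seq I) (F : I -> T -> R) x :
  (forall i, i \in r -> {for x, continuous (F i)}) ->
  {for x, continuous (fun z => \prod_(i <- r) F i z)}.
Proof.
elim: r => [_|i r IH cF].
  rewrite (_ : (fun z => _) = cst 1); first exact: cst_continuous.
  by apply/funext => z; rewrite big_nil.
rewrite (_ : (fun z => _) = fun z => F i z * \prod_(j <- r) F j z); last first.
  by apply/funext => z; rewrite big_cons.
apply: continuous_atM; first by apply: cF; rewrite inE eqxx.
by apply: IH => j jr; apply: cF; rewrite inE jr orbT.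
Qed.

End ContinuousAt.

Section ImplicitFunction.
Context {R : realType} {d : nat}.
Variables (phi : 'rV[R]_d.+1 -> R) (t : R).
Hypothesis phi_cont : continuous phi.
Hypothesis phi_derivable0 : forall x, derivable phi x (delta_mx ord0 ord0).
Hypothesis D0_gt0 : forall x, 0 < partial ord0 phi x.
Hypothesis D0_cont : continuous (partial ord0 phi).
Hypothesis phi_lim : forall y, phi (pcons y0 y) @[y0 --> +oo] --> +oo.
Implicit Types (y z : 'rV[R]_d).
Local Notation U := (Ut phi t).
Local Notation xi := (xi phi t).

Lemma phi_pcons_cont y : continuous (fun r => phi (pcons r y)).
Proof. by move=> r; exact: (continuous_comp (@continuous_pcons0 R d y r) (@phi_cont _)). Qed.

Lemma phi_pcons_lt y (r s : R) : r < s -> phi (pcons r y) < phi (pcons s y).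
Proof.
move=> rs; have [c _ E] := MVT_line phi_derivable0 (pcons r y) (s - r).
have Es : pcons s y = (s - r) *: delta_mx ord0 ord0 + pcons r y.
  by rewrite -pcons0_line subrK.
rewrite -subr_gt0 Es E.
by rewrite mulr_gt0// ?subr_gt0//; exact: D0_gt0.
Qed.

Lemma xiP y : U y -> phi (pcons (xi y) y) = t.
Proof. by move=> Uy; exact: (@xgetPex _ 0 [set r | phi (pcons r y) = t] Uy). Qed.

Lemma xi_unique y r : phi (pcons r y) = t -> xi y = r.
Proof.
move=> rt; have Uy : U y by exists r.
have E := xiP Uy; apply/eqP; rewrite eq_le !leNgt; apply/andP; split; apply/negP.
  by move/(phi_pcons_lt y); rewrite E rt ltxx.
by move/(phi_pcons_lt y); rewrite E rt ltxx.
Qed.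

Lemma phi_IVT y (r s : R) : r <= s -> phi (pcons r y) <= t <= phi (pcons s y) ->
  U y /\ r <= xi y <= s.
Proof.
move=> rs /andP[rt ts].
have [||c] := @IVT R (fun r => phi (pcons r y)) r s t rs.
- by apply: continuous_subspaceT; exact: phi_pcons_cont.
- by rewrite ge_min rt/= le_max ts orbT.
by rewrite in_itv /= => cI E; split; [exists c|rewrite (xi_unique E)].
Qed.

(** On the line over y the function phi is unbounded above, so by the intermediate
    value theorem it misses the value t only by staying above it. *)
Lemma notin_Ut y r : ~ U y -> t < phi (pcons r y).
Proof.
move=> Uy; rewrite ltNge; apply/negP => rt; apply: Uy.
have /cvgryPge/(_ t) [M [_ HM]] := phi_lim y.
pose s := Num.max r (M + 1).
have [] := @phi_IVT y r s; rewrite ?le_max ?lexx// rt /=.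
by apply: HM; rewrite lt_max ltrDl ltr01 orbT.
Qed.

(** phi is below t at xi y - e and above t at xi y + e. Both inequalities persist
    for z near y, and the intermediate value theorem traps xi z between the two
    points. This gives at once that the set U is open and that xi is continuous. *)
Lemma xi_near y e : U y -> 0 < e -> \forall z \near y, U z /\ `|xi z - xi y| <= e.
Proof.
move=> Uy e0; have E := xiP Uy.
have c (r : R) : (fun z => phi (pcons r z)) @ y --> phi (pcons r y).
  exact: (continuous_comp (@continuous_pcons R d r y) (@phi_cont _)).
have H1 : \forall z \near y, phi (pcons (xi y - e) z) < t.
  by apply: (cvgr_lt _ (c _)); rewrite -[ltRHS]E phi_pcons_lt// gtrBl.
have H2 : \forall z \near y, t < phi (pcons (xi y + e) z).
  by apply: (cvgr_gt _ (c _)); rewrite -[ltLHS]E phi_pcons_lt// ltrDl.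
apply: filterS2 H1 H2 => z z1 z2.
have [||Uz /andP[x1 x2]] := @phi_IVT z (xi y - e) (xi y + e).
- by rewrite lerD2l (le_trans _ (ltW e0))// oppr_le0 ltW.
- by rewrite !ltW.
by split=> //; rewrite ler_norml; lra.
Qed.

Lemma open_Ut : open U.
Proof.
rewrite openE => y Uy; rewrite /interior.
by apply: filterS (xi_near Uy ltr01) => z [].
Qed.

Lemma xi_cont y : U y -> {for y, continuous xi}.
Proof.
move=> Uy; have H : xi @ y --> xi y; last exact: H.
apply/(@cvgrPdist_le _ _ _ (nbhs y) (nbhs_filter y)) => e e0; by apply: filterS (xi_near Uy e0) => z []; rewrite distrC.
Qed.

Lemma xi_lt y r : U y -> t < phi (pcons r y) -> xi y < r.
Proof.
move=> Uy; rewrite -{1}(xiP Uy) => H; rewrite ltNge; apply/negP.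
rewrite le_eqVlt => /orP[/eqP E|/(phi_pcons_lt y)]; first by rewrite E ltxx in H.
by rewrite ltNge ltW.
Qed.

(** The value of phi is t at both ends of the step from (xi y, y) to (xi z, z).
    Going first in direction 0 and then in direction i, two mean value steps give
    dx C' + s A' = 0 with A', C' close to the partial derivatives A, C at
    (xi y, y), so that dx / s = - A' / C' tends to - A / C. *)
Lemma is_derive_xi y i : U y ->
  (forall x, derivable phi x (delta_mx ord0 (lift ord0 i))) -> continuous (partial (lift ord0 i) phi) ->
  is_derive y (delta_mx ord0 i) xi
   (- (partial (lift ord0 i) phi (pcons (xi y) y) / partial ord0 phi (pcons (xi y) y))).
Proof.
move=> Uy dphi cDi; set p := pcons (xi y) y; set A := partial _ phi p.
have C0 := D0_gt0 p; set C := partial ord0 phi p in C0 *.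
apply/is_derive_epsP => e e0.
have [eta eta0 close] := quotient_near A C0 e0.
have [d1 d10 H1] := @continuous_plane R _ _ p (delta_mx ord0 (lift ord0 i))
  (delta_mx ord0 ord0) (cDi p) _ eta0.
have [d2 d20 H2] := @continuous_plane R _ _ p (delta_mx ord0 (lift ord0 i))
  (delta_mx ord0 ord0) (@D0_cont p) _ eta0.
have dd0 : 0 < Num.min d1 d2 / 2 by rewrite divr_gt0// lt_min d10.
have dd1 : Num.min d1 d2 / 2 < Num.min d1 d2.
  by rewrite ltr_pdivrMr// ltr_pMr ?ltr1n// lt_min d10.
have cl : (fun s : R => s *: delta_mx ord0 i + y) @ (0 : R) --> y.
  suff : (fun s : R => s *: delta_mx ord0 i + y) @ (0 : R) --> 0 *: delta_mx ord0 i + y.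
    by rewrite scale0r add0r.
  by apply: cvgD; [apply: cvgZr_tmp; exact: cvg_id|exact: cvg_cst].
have /nbhs_ballP[d3 /= d30 H3] := cl _ (xi_near Uy dd0).
exists (Num.min d1 d3); first by rewrite lt_min d10.
move=> s; rewrite lt_min => /andP[s1 s3].
have [Uz dz] : U (s *: delta_mx ord0 i + y) /\
    `|xi (s *: delta_mx ord0 i + y) - xi y| <= Num.min d1 d2 / 2.
  by apply: H3; rewrite -ball_normE /= sub0r normrN.
set z := s *: _ + y in Uz dz *; set dx := xi z - xi y in dz *.
have [dx1 dx2] : `|dx| < d1 /\ `|dx| < d2.
  by have := le_lt_trans dz dd1; rewrite lt_min => /andP.
have [c cs E1] := MVT_line dphi (pcons (xi z) y) s.
have [c' cdx E2] := MVT_line phi_derivable0 p dx.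
have Ez : pcons (xi z) y = dx *: delta_mx ord0 ord0 + p.
  by rewrite /p -pcons0_line subrK.
have {}E1 : phi (pcons (xi z) z) - phi (pcons (xi z) y) =
    s * partial (lift ord0 i) phi (c *: delta_mx ord0 (lift ord0 i) + (dx *: delta_mx ord0 ord0 + p)).
  by rewrite -Ez -E1 /z pcons_line.
have B1 := H1 c dx (le_lt_trans cs s1) dx1.
have B2 := H2 0 c' _ (le_lt_trans cdx dx2).
rewrite normr0 scale0r add0r in B2; have {}B2 := B2 d20.
move: E1 E2 B1 B2; rewrite Ez (xiP Uz) (xiP Uy) -/A -/C.
rewrite -[phi (_ *: _ + p)]/(phi (dx *: delta_mx ord0 ord0 + p)).
set A' := partial _ phi _; set P := phi _.
rewrite -[X in _ = dx * X -> _]/(partial ord0 phi (c' *: delta_mx ord0 ord0 + p)).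
set C' := partial ord0 phi _ => E1 E2 B1 B2.
have [C'gt0 cl'] := close A' C' B1 B2.
have Edx : dx = - (s * (A' / C')).
  have H : dx * C' = - (s * A') by rewrite -E2 -E1 opprB.
  by rewrite -[LHS](mulfK (lt0r_neq0 C'gt0)) H mulNr mulrA.
have -> : dx - s * - (A / C) = s * - (A' / C' - A / C).
  by rewrite Edx mulrN mulrN opprK mulrBr opprB addrC.
by rewrite normrM normrN mulrC ler_wpM2r.
Qed.

Lemma is_derive_graph (F : 'rV[R]_d.+1 -> R) y i : U y ->
    (forall x, derivable phi x (delta_mx ord0 (lift ord0 i))) ->
    continuous (partial (lift ord0 i) phi) ->
    (forall x, derivable F x (delta_mx ord0 ord0)) ->
    (forall x, derivable F x (delta_mx ord0 (lift ord0 i))) ->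
    continuous (partial (lift ord0 i) F) ->
  is_derive y (delta_mx ord0 i) (fun z => F (pcons (xi z) z))
    (partial (lift ord0 i) F (pcons (xi y) y) +
     partial ord0 F (pcons (xi y) y) *
     - (partial (lift ord0 i) phi (pcons (xi y) y) / partial ord0 phi (pcons (xi y) y))).
Proof.
move=> Uy dphi cDi dF0 dFi cDF; set X' := - (_ / _).
pose X (r : R) := xi (r *: delta_mx ord0 i + y).
have X0 : X 0 = xi y by rewrite /X scale0r add0r.
have dX : is_derive (0 : R) (1 : R) X X'.
  apply: (@is_derive_line R _ xi y (delta_mx ord0 i)); rewrite scale0r add0r.
  exact: is_derive_xi.
have Ep : pcons (xi y) y = X 0 *: delta_mx ord0 ord0 + pcons 0 y by rewrite X0 -pconsE.
have := is_derive_curve dF0 dFi (cDF (X 0 *: delta_mx ord0 ord0 + pcons 0 y)) dX.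
rewrite -Ep addrC mulrC => H; apply: is_derive_of_line.
rewrite (_ : (fun r : R => _) = fun r : R => F (r *: delta_mx ord0 (lift ord0 i) +
  (X r *: delta_mx ord0 ord0 + pcons 0 y)))//.
by apply/funext => r; rewrite pcons_line -pconsE.
Qed.

End ImplicitFunction.

(** * Combinatorics of the derivative terms *)

Section Terms.
Variable d : nat.
Implicit Types (i : 'I_d) (eta : multi d) (alpha : multi d.+1) (s : seq (multi d.+1)).
Implicit Types (T : nat * seq (multi d.+1)).

Definition unit0 : multi d.+1 := munit ord0.
Definition unitS i : multi d.+1 := munit (lift ord0 i).

(** The four products whose sum is the i-th derivative of the ratio m_alpha, where
    m_alpha stands for - D^alpha phi / D^0 phi at (xi y, y): numerator and denominator
    are both differentiated, each directly in y_i and through xi, whose derivative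
    is m_(e_i). The minus sign in m_alpha is chosen so that all four products have
    coefficient 1. *)
Definition factor_terms i alpha : seq (seq (multi d.+1)) :=
  [:: [:: alpha + unitS i]; [:: alpha + unit0; unitS i]; [:: alpha; unit0 + unitS i]; [:: alpha; unit0 + unit0; unitS i]].

Fixpoint product_terms i s : seq (seq (multi d.+1)) :=
  if s is alpha :: s' then
    [seq f ++ s' | f <- factor_terms i alpha] ++ [seq alpha :: s2 | s2 <- product_terms i s']
  else [::].

(** A pair (beta, s) encodes the product of the beta-th derivative of rho_0 at xi y
    and of the ratios m_alpha over alpha in s. The first new term comes from rho_0,
    the others from the ratios. *)
Definition term_terms i T : seq (nat * seq (multi d.+1)) :=
  (T.1.+1, unitS i :: T.2) :: [seq (T.1, s) | s <- product_terms i T.2].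

(** The terms of the derivative of Phi_0 (xi y) along the list w, innermost
    derivative last. The first differentiation turns Phi_0 into rho_0, so the recursion
    starts at lists of length one. *)
Fixpoint deriv_terms (w : seq 'I_d) : seq (nat * seq (multi d.+1)) :=
  match w with
  | [::] => [::]
  | [:: i] => [:: (0%N, [:: unitS i])]
  | i :: w' => flatten [seq term_terms i T | T <- deriv_terms w']
  end.

(** The constraints on the parameters of a function of type (0, eta), the
    componentwise identity being split into its component 0 and the others. Here
    |eta| > 0 is implied. *)
Definition typed eta T : Prop :=
  [/\ forall alpha, alpha \in T.2 -> [/\ alpha != 0, alpha != unit0 & (alpha ord0 <= mdeg eta)%N],
      (size T.2 < 2 * mdeg eta)%N, (T.1 < mdeg eta)%N, (0 < size T.2)%N &
      (T.1 + \sum_(alpha <- T.2) alpha ord0 = (size T.2).-1)%N /\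
      forall i, (\sum_(alpha <- T.2) alpha (lift ord0 i))%N = eta i].

Lemma size_product_terms i s : size (product_terms i s) = (4 * size s)%N.
Proof.
elim: s => //= alpha s IH.
by rewrite size_map IH mulnS.
Qed.

Lemma product_terms_cons i alpha s : product_terms i (alpha :: s) =
  [seq f ++ s | f <- factor_terms i alpha] ++ [seq alpha :: s2 | s2 <- product_terms i s].
Proof. by []. Qed.

(** What one differentiation does to the parameters: at most two more factors, every
    new factor raises the total order in y_0 by one, the order in y_i goes up by one, and
    the only new multi-indices are those listed. *)
Lemma product_termsP i s s2 : s2 \in product_terms i s ->
  [/\ (size s <= size s2 <= size s + 2)%N,
     (\sum_(alpha <- s2) alpha ord0 + size s = \sum_(alpha <- s) alpha ord0 + size s2)%N,
     (forall j, \sum_(alpha <- s2) alpha (lift ord0 j) =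
       \sum_(alpha <- s) alpha (lift ord0 j) + (j == i))%N &
     forall alpha, alpha \in s2 -> alpha \in s \/
       [\/ exists2 alpha', alpha' \in s & alpha = alpha' + unitS i \/ alpha = alpha' + unit0,
          alpha = unitS i, alpha = unit0 + unitS i | alpha = unit0 + unit0]].
Proof.
have Z j : unitS i (lift ord0 j) = (j == i) :> nat by rewrite ffunE (inj_eq lift_inj).
have Z0 : unitS i ord0 = 0%N by rewrite ffunE.
have W j : unit0 (lift ord0 j) = 0%N by rewrite ffunE.
have W0 : unit0 ord0 = 1%N by rewrite ffunE eqxx.
elim: s s2 => [//|alpha s IH] s2; rewrite product_terms_cons mem_cat.
have inS a : a \in s -> a \in alpha :: s by rewrite inE orbC => ->.
have E (a b : multi d.+1) k : (a + b) k = (a k + b k)%N by rewrite ffunE.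
case/orP => [/mapP[f + ->]|/mapP[s3 /IH[A1 A2 A3 A4] ->]].
  rewrite !inE => /or4P[]/eqP->.
- split=> [/=|/=|j|a]; rewrite ?big_cons ?E ?Z0 /=; try lia.
  + by rewrite ?big_cons ?E ?Z ?W; move: (nat_of_bool _) => z; lia.
  + rewrite inE => /orP[/eqP->|/inS]; [right|by left].
    by apply: Or41; exists alpha; rewrite ?inE ?eqxx//; left.
- split=> [/=|/=|j|a]; rewrite ?big_cons ?E ?Z0 ?W0 /=; try lia.
  + by rewrite ?big_cons ?E ?Z ?W; move: (nat_of_bool _) => z; lia.
  + rewrite !inE => /or3P[/eqP->|/eqP->|/inS]; [right|right|by left].
      by apply: Or41; exists alpha; rewrite ?inE ?eqxx//; right.
    exact: Or42.
- split=> [/=|/=|j|a]; rewrite ?big_cons ?E ?Z0 ?W0 /=; try lia.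
  + by rewrite ?big_cons ?E ?Z ?W; move: (nat_of_bool _) => z; lia.
  + rewrite !inE => /or3P[/eqP->|/eqP->|/inS]; [left|right|by left].
      by rewrite ?inE eqxx.
    exact: Or43.
- split=> [/=|/=|j|a]; rewrite ?big_cons ?E ?Z0 ?W0 /=; try lia.
  + by rewrite ?big_cons ?E ?Z ?W; move: (nat_of_bool _) => z; lia.
  + rewrite !inE => /or4P[/eqP->|/eqP->|/eqP->|/inS]; [left|right|right|by left].
    * by rewrite ?inE eqxx.
    * exact: Or44.
    * exact: Or42.
- split=> [/=|/=|j|a]; rewrite ?big_cons /=; try lia.
  + by rewrite ?big_cons A3; move: (nat_of_bool _) => z; lia.
  + rewrite inE => /orP[/eqP->|/A4]; first by left; rewrite inE eqxx.
    case=> [/inS|]; first by left.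
    case=> [[a' /inS ? ?]|?|?|?]; right; [apply: Or41|exact: Or42|exact: Or43|exact: Or44].
    by exists a'.
Qed.

Lemma mdegD1 eta i : mdeg (eta + munit i) = (mdeg eta).+1.
Proof.
by rewrite -[eta in LHS]mcount_mseq -mcount_cons mdeg_mcount /= -mdeg_mcount mcount_mseq.
Qed.

Lemma unitS_neq0 i : unitS i != 0.
Proof. by apply/eqP => /ffunP/(_ (lift ord0 i)); rewrite !ffunE eqxx. Qed.

Lemma unitS_neq i : unitS i != unit0.
Proof. by apply/eqP => /ffunP/(_ ord0); rewrite !ffunE. Qed.

Lemma typed_unit i : typed (munit i) (0%N, [:: unitS i]).
Proof.
have D : mdeg (munit i) = 1%N.
  by rewrite -[munit i]add0r mdegD1 /mdeg big1// => j _; rewrite ffunE.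
split; rewrite /= ?D//.
  by move=> alpha; rewrite inE => /eqP->; split; rewrite ?unitS_neq0 ?unitS_neq// ffunE.
split; first by rewrite big_seq1 ffunE.
by move=> j; rewrite big_seq1 !ffunE (inj_eq lift_inj).
Qed.

Lemma typed_term_terms eta i T T2 : typed eta T -> T2 \in term_terms i T ->
  typed (eta + munit i) T2.
Proof.
case: T => beta s [/= H1 H2 H3 H4 [H5 H6]].
have H1' alpha : alpha \in s -> [/\ alpha != 0, alpha != unit0 & (alpha ord0 <= (mdeg eta).+1)%N].
  by move=> /H1[? ? ?]; split=> //; exact: leqW.
have E (a b : multi d.+1) k : (a + b) k = (a k + b k)%N by rewrite ffunE.
have Ed (a b : multi d) k : (a + b) k = (a k + b k)%N by rewrite ffunE.
rewrite /term_terms inE => /orP[/eqP->|/mapP[s2 /product_termsP[/andP[A1 A1'] A2 A3 A4] ->]];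
    rewrite /typed mdegD1 /=; try (rewrite /= in A1 A1' A2 A3 A4).
- split; try lia.
  + move=> alpha; rewrite inE => /orP[/eqP->|]; last exact: H1'.
    by split; rewrite ?unitS_neq0 ?unitS_neq// ffunE.
  + split; first by rewrite big_cons ffunE /=; lia.
    by move=> j; rewrite big_cons H6 Ed !ffunE (inj_eq lift_inj) addnC.
- split; try lia; last first.
    split; first by lia.
    by move=> j; rewrite A3 H6 Ed !ffunE.
  move=> alpha /A4[|]; first exact: H1'.
  case=> [[a' /H1[a'0 a'e a'd] [|]]|||] ->; rewrite ?E ?ffunE /=; split=> //; try lia.
  + apply/eqP => /ffunP/(_ (lift ord0 i)); rewrite !ffunE eqxx; lia.
  + apply/eqP => /ffunP/(_ (lift ord0 i)); rewrite !ffunE eqxx /=; lia.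
  + apply/eqP => /ffunP/(_ ord0); rewrite !ffunE eqxx; lia.
  (* alpha + e_0 = e_0 would force alpha = 0. *)
  + apply/eqP => H; move/eqP: a'0; apply; apply/ffunP => k.
    have Hk : (a' k + unit0 k = unit0 k)%N by rewrite -E H.
    by rewrite [RHS]ffunE; apply/eqP; rewrite -(eqn_add2r (unit0 k)) Hk add0n.
  + exact: unitS_neq0.
  + exact: unitS_neq.
  + apply/eqP => /ffunP/(_ ord0); rewrite !ffunE eqxx; lia.
  + apply/eqP => /ffunP/(_ (lift ord0 i)); rewrite !ffunE eqxx; lia.
  + apply/eqP => /ffunP/(_ ord0); rewrite !ffunE eqxx; lia.
  + apply/eqP => /ffunP/(_ ord0); rewrite !ffunE eqxx; lia.
Qed.

Lemma deriv_terms_cons2 i j w : deriv_terms (i :: j :: w) =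
  flatten [seq term_terms i T | T <- deriv_terms (j :: w)].
Proof. by []. Qed.

Lemma typed_deriv_terms w T : T \in deriv_terms w -> typed (mcount w) T.
Proof.
elim: w T => [//|i [|j w] IH] T.
  rewrite /= inE => /eqP->; rewrite mcount_cons (_ : mcount [::] = 0) ?add0r; first exact: typed_unit.
  by apply/ffunP => k; rewrite !ffunE.
rewrite deriv_terms_cons2 => /flatten_mapP[T' /IH T't] TT'.
by rewrite mcount_cons; exact: typed_term_terms T't TT'.
Qed.

(** A term with r ratios has 4 r + 1 derivative terms. A term of type (0, eta)
    has r < 2 |eta|, so each differentiation of a term of order |eta| = k multiplies
    the number of terms by at most 8 k. *)
Lemma size_deriv_terms w :
  (size (deriv_terms w) <= 8 ^ (size w).-1 * ((size w).-1)`!)%N.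
Proof.
elim: w => [//|i [//|j w] IH]; rewrite deriv_terms_cons2.
rewrite size_flatten sumnE !big_map.
apply: (@leq_trans (\sum_(T <- deriv_terms (j :: w)) 8 * size (j :: w))%N).
  rewrite big_seq_cond [leqRHS]big_seq_cond; apply: leq_sum => T; rewrite andbT => /typed_deriv_terms[_ + _ _ _].
  by rewrite mdeg_mcount /= size_map size_product_terms /=; lia.
rewrite big_const_seq count_predT iter_addn_0 /= expnS factS [leqLHS]mulnC.
rewrite [leqRHS](_ : _ = (8 ^ size w * (size w)`! * (8 * (size w).+1))%N); last by ring.
by rewrite leq_mul2r IH orbT.
Qed.

End Terms.

(** * Derivatives of the functions of type (0, eta) *)

Section TermValues.
Context {R : realType} {d : nat}.
Variables (phi : 'rV[R]_d.+1 -> R) (t : R) (rho0 : R -> R) (nu : multi d).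
Local Notation nu' := (mcons (mdeg nu).+1 nu).
Hypothesis phi_Cmulti : Cmulti nu' phi.
Hypothesis D0_gt0 : forall x, 0 < partial ord0 phi x.
Hypothesis phi_lim : forall y, phi (pcons y0 y) @[y0 --> +oo] --> +oo.
Hypothesis rho0_Ck : Ck (mdeg nu) rho0.
Implicit Types (y z : 'rV[R]_d) (i : 'I_d) (eta : multi d) (alpha : multi d.+1).
Implicit Types (s : seq (multi d.+1)) (T : nat * seq (multi d.+1)).
Local Notation U := (Ut phi t).
Local Notation xi := (xi phi t).
Local Notation unit0 := (unit0 d).

Definition graph y := pcons (xi y) y.

Definition level_ratio alpha y : R := - (mderiv alpha phi (graph y) / partial ord0 phi (graph y)).

Definition term_value T y : R := derive1n T.1 rho0 (xi y) * \prod_(alpha <- T.2) level_ratio alpha y.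

Lemma mle_mconsP (k : nat) alpha : reflect
  ((alpha ord0 <= k)%N /\ forall i, (alpha (lift ord0 i) <= nu i)%N) (mle alpha (mcons k nu)).
Proof.
apply: (iffP forallP) => [H|[H0 H] j].
  by split => [|i]; [have := H ord0|have := H (lift ord0 i)]; rewrite ffunE ?unlift_none ?liftK.
by rewrite ffunE; case: unliftP => [i ->|->] /=; [exact: H|exact: H0].
Qed.

Lemma mle_unit0 : mle unit0 nu'.
Proof. by apply/mle_mconsP; split=> [|i]; rewrite ffunE ?eqxx. Qed.

Lemma phi_continuous : continuous phi.
Proof.
have := (phi_Cmulti (_ : mle 0 nu')).2; rewrite mderiv0; apply.
by apply/mle_mconsP; split=> [|i]; rewrite ffunE.
Qed.

Lemma mderiv_cont alpha : mle alpha nu' -> continuous (mderiv alpha phi).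
Proof. by move=> /phi_Cmulti[]. Qed.

Lemma D0_continuous : continuous (partial ord0 phi).
Proof. by rewrite -mderiv_unit; exact: mderiv_cont mle_unit0. Qed.

Lemma phi_derivable j : mle (munit j) nu' -> forall x, derivable phi x (delta_mx ord0 j).
Proof.
move=> le_j x; rewrite -(mderiv0 phi).
by case: (@is_derive_mderiv R _ nu' phi 0 j x phi_Cmulti); rewrite add0r.
Qed.

Lemma mderiv_partial alpha j : mle (alpha + munit j) nu' ->
  [/\ forall x, derivable (mderiv alpha phi) x (delta_mx ord0 j),
      partial j (mderiv alpha phi) = mderiv (alpha + munit j) phi &
      continuous (partial j (mderiv alpha phi))].
Proof.
move=> le_a; have H x := is_derive_mderiv x phi_Cmulti le_a.
have E : partial j (mderiv alpha phi) = mderiv (alpha + munit j) phi.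
  by apply/funext => x; case: (H x).
by split=> [x||]; [case: (H x)|exact: E|rewrite E; exact: mderiv_cont].
Qed.

Let open_U : open U.
Proof. exact: (open_Ut phi_continuous (phi_derivable mle_unit0) D0_gt0). Qed.

Lemma graph_cont y : U y -> {for y, continuous graph}.
Proof.
move=> Uy; apply: (@cvg_pcons R d _ (nbhs y) (nbhs_filter y) xi id (xi y) y); last exact: cvg_id.
exact: (xi_cont phi_continuous (phi_derivable mle_unit0) D0_gt0 Uy).
Qed.

Lemma level_ratio_cont alpha y : U y -> mle alpha nu' -> {for y, continuous (level_ratio alpha)}.
Proof.
move=> Uy le_a; apply: continuous_atN; apply: continuous_atM.
  exact: (continuous_at_comp (graph_cont Uy) (@mderiv_cont _ le_a _)).
apply: continuous_atV; first by rewrite lt0r_neq0.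
exact: (continuous_at_comp (graph_cont Uy) (@D0_continuous _)).
Qed.

Lemma term_value_cont T y : U y -> (T.1 <= mdeg nu)%N ->
  (forall alpha, alpha \in T.2 -> mle alpha nu') -> {for y, continuous (term_value T)}.
Proof.
move=> Uy le1 le2; apply: continuous_atM.
  apply: continuous_at_comp; last exact: rho0_Ck.2.
  exact: (xi_cont phi_continuous (phi_derivable mle_unit0) D0_gt0 Uy).
by apply: continuous_at_prod => alpha /le2 ?; exact: level_ratio_cont.
Qed.

(** The chain rule for D^alpha phi (xi y, y), with the derivative of xi recognized as
    one of the ratios. *)
Lemma is_derive_graph_mderiv alpha y i : U y -> mle (unitS i) nu' ->
  mle (alpha + unit0) nu' -> mle (alpha + unitS i) nu' ->
  is_derive y (delta_mx ord0 i) (fun z => mderiv alpha phi (graph z))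
    (mderiv (alpha + unitS i) phi (graph y) + mderiv (alpha + unit0) phi (graph y) * level_ratio (unitS i) y).
Proof.
move=> Uy le_i /mderiv_partial[d0 E0 _] /mderiv_partial[di Ei ci].
have cphi : continuous (partial (lift ord0 i) phi).
  by rewrite -mderiv_unit; exact: mderiv_cont.
have := is_derive_graph phi_continuous (phi_derivable mle_unit0) D0_gt0 D0_continuous Uy
  (phi_derivable le_i) cphi d0 di ci.
by rewrite E0 Ei /level_ratio mderiv_unit.
Qed.

Lemma is_derive_level_ratio alpha y i : U y -> mle (unitS i) nu' ->
  mle (alpha + unit0) nu' -> mle (alpha + unitS i) nu' -> mle (unit0 + unit0) nu' -> mle (unit0 + unitS i) nu' ->
  is_derive y (delta_mx ord0 i) (level_ratio alpha)
    (\sum_(f <- factor_terms i alpha) \prod_(a <- f) level_ratio a y).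
Proof.
move=> Uy le_i la0 lai l00 l0i.
have dN := is_derive_graph_mderiv Uy le_i la0 lai.
have dC := is_derive_graph_mderiv Uy le_i l00 l0i.
rewrite mderiv_unit in dC.
pose N z := mderiv alpha phi (graph z); pose C z := partial ord0 phi (graph z).
have C0 : C y != 0 by rewrite lt0r_neq0 ?D0_gt0.
have dV : is_derive y (delta_mx ord0 i) (fun z => (C z)^-1)
    (- (C y) ^- 2 *: (mderiv (unit0 + unitS i) phi (graph y) + mderiv (unit0 + unit0) phi (graph y) * level_ratio (unitS i) y)).
  have dC' : derivable C y (delta_mx ord0 i) by case: dC.
  split; first exact: derivableV.
  by rewrite deriveV//; congr (_ *: _); case: dC.
have := is_deriveN (is_deriveM dN dV); rewrite -[- _]/(level_ratio alpha) => H.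
apply: (is_derive_eq H).
rewrite /factor_terms !big_cons !big_nil /GRing.scale /= !mulr1 addr0.
rewrite [level_ratio (alpha + unitS i)]/level_ratio [level_ratio (alpha + unit0)]/level_ratio [level_ratio alpha]/level_ratio
  [level_ratio (unit0 + unitS i)]/level_ratio [level_ratio (unit0 + unit0)]/level_ratio -/(C y).
by field.
Qed.

Lemma is_derive_product s y i : U y -> mle (unitS i) nu' -> mle (unit0 + unit0) nu' -> mle (unit0 + unitS i) nu' ->
  (forall alpha, alpha \in s -> mle (alpha + unit0) nu' /\ mle (alpha + unitS i) nu') ->
  is_derive y (delta_mx ord0 i) (fun z => \prod_(alpha <- s) level_ratio alpha z)
    (\sum_(s2 <- product_terms i s) \prod_(a <- s2) level_ratio a y).
Proof.
move=> Uy le_i l00 l0i; elim: s => [_|alpha s IH le_s].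
  rewrite big_nil; under [X in is_derive _ _ X _]eq_fun do rewrite big_nil.
  exact: is_derive_cst.
under [X in is_derive _ _ X _]eq_fun do rewrite big_cons.
have [la0 lai] : mle (alpha + unit0) nu' /\ mle (alpha + unitS i) nu'.
  by apply: le_s; rewrite inE eqxx.
have dr := is_derive_level_ratio Uy le_i la0 lai l00 l0i.
have dp : is_derive y (delta_mx ord0 i) (fun z => \prod_(alpha <- s) level_ratio alpha z)
    (\sum_(s2 <- product_terms i s) \prod_(a <- s2) level_ratio a y).
  by apply: IH => a aS; apply: le_s; rewrite inE aS orbT.
apply: (is_derive_eq (is_deriveM dr dp)).
rewrite product_terms_cons big_cat !big_map addrC; congr (_ + _).
  rewrite /GRing.scale /= mulr_sumr; apply: eq_bigr => f _.
  by rewrite big_cat /= mulrC.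
rewrite /GRing.scale /= mulr_sumr; apply: eq_bigr => f _.
by rewrite big_cons.
Qed.

Lemma is_derive_term_value T y i : U y -> (T.1 < mdeg nu)%N ->
  mle (unitS i) nu' -> mle (unit0 + unit0) nu' -> mle (unit0 + unitS i) nu' ->
  (forall alpha, alpha \in T.2 -> mle (alpha + unit0) nu' /\ mle (alpha + unitS i) nu') ->
  is_derive y (delta_mx ord0 i) (term_value T) (\sum_(T2 <- term_terms i T) term_value T2 y).
Proof.
move=> Uy le1 le_i l00 l0i le_s.
have dp := is_derive_product Uy le_i l00 l0i le_s.
have dr : is_derive y (delta_mx ord0 i) (fun z => derive1n T.1 rho0 (xi z))
    (derive1n T.1.+1 rho0 (xi y) * level_ratio (unitS i) y).
  have cphi : continuous (partial (lift ord0 i) phi).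
    by rewrite -mderiv_unit; exact: mderiv_cont.
  have dxi := is_derive_xi phi_continuous (phi_derivable mle_unit0) D0_gt0 D0_continuous Uy
    (phi_derivable le_i) cphi.
  apply: is_derive_of_line.
  have dl : is_derive (0 : R) (1 : R) (fun r : R => xi (r *: delta_mx ord0 i + y)) (level_ratio (unitS i) y).
    apply: (@is_derive_line R _ xi y (delta_mx ord0 i)); rewrite scale0r add0r.
    by rewrite /level_ratio mderiv_unit.
  have dd (r : R) : is_derive r (1 : R) (derive1n T.1 rho0) (derive1n T.1.+1 rho0 r).
    by rewrite derive1nS derive1E; apply: derivableP; exact: rho0_Ck.1.
  have E0 : xi y = xi (0 *: delta_mx ord0 i + y) by rewrite scale0r add0r.
  by rewrite E0; exact: (is_derive1_comp (dd _) dl).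
apply: (is_derive_eq (is_deriveM dr dp)).
rewrite /term_terms big_cons big_map /term_value /= big_cons addrC /GRing.scale /= mulr_sumr.
by congr (_ + _); rewrite mulrC -mulrA.
Qed.

Definition zero_ext (F : 'rV[R]_d -> R) y := if y \in U then F y else 0.

Hypothesis decay : forall eta, eta != 0 -> mle eta nu -> forall T, typed eta T ->
  forall z, boundary U z -> term_value T @ within U (nbhs z) --> (0 : R).

(** A point outside the open set U is either a boundary point or has a
    neighbourhood that does not meet U, where there is nothing to prove. *)
Lemma within_boundary (F : 'rV[R]_d -> R) z :
  (boundary U z -> F @ within U (nbhs z) --> (0 : R)) -> ~ U z ->
  F @ within U (nbhs z) --> (0 : R).
Proof.
move=> FU Uz; have [cz|cz] := pselect (closure U z).
  by apply: FU; split => // /interior_subset.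
move=> A _; suff : nbhs z [set y | U y -> A (F y)] by [].
have : nbhs z (~` closure U).
  by apply: open_nbhs_nbhs; split => //; exact/closed_openC/closed_closure.
by apply: filterS => y yU Uy; exfalso; apply: yU; exact: subset_closure.
Qed.

Lemma mle_mdeg (k : nat) (eta1 eta2 : multi k) : mle eta1 eta2 -> (mdeg eta1 <= mdeg eta2)%N.
Proof. by move=> /forallP H; exact: leq_sum. Qed.

Lemma typed_le eta T alpha : typed eta T -> alpha \in T.2 ->
  (alpha ord0 <= mdeg eta)%N /\ forall i, (alpha (lift ord0 i) <= eta i)%N.
Proof.
move=> [H1 _ _ _ [_ H6]] aT; split; first by have [] := H1 _ aT.
by move=> i; rewrite -H6 (big_rem alpha)//= leq_addr.
Qed.

Lemma typed_mle eta T : typed eta T -> mle eta nu ->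
  (T.1 <= mdeg nu)%N /\ forall alpha, alpha \in T.2 -> mle alpha nu'.
Proof.
move=> tT le_eta; have le_deg := mle_mdeg le_eta; split.
  by case: tT => _ _ + _ _; lia.
move=> alpha /(typed_le tT)[a0 aS]; apply/mle_mconsP; split; first by lia.
by move=> i; apply: leq_trans (aS i) _; exact: (forallP le_eta).
Qed.

Lemma mle_unitS eta i : mle (eta + munit i) nu -> mle (unitS i) nu'.
Proof.
move=> /forallP le_nu; apply/mle_mconsP; split=> [|j]; rewrite !ffunE//.
rewrite (inj_eq lift_inj); have := le_nu j; rewrite !ffunE.
by apply: leq_trans; exact: leq_addl.
Qed.

(** All derivatives that occur when a term of type (0, eta) is differentiated once
    more exist and are continuous. Their order in y_0 is at most |eta| + 1, which is
    where phi has to be of order |nu| + 1 in y_0. *)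
Lemma typed_mleD eta T i : typed eta T -> mle (eta + munit i) nu ->
  [/\ (T.1 < mdeg nu)%N, mle (unitS i) nu', mle (unit0 + unit0) nu', mle (unit0 + unitS i) nu' &
   forall alpha, alpha \in T.2 -> mle (alpha + unit0) nu' /\ mle (alpha + unitS i) nu'].
Proof.
move=> tT le_eta; have le_deg := mle_mdeg le_eta; rewrite mdegD1 in le_deg.
have [_ _ T1 _ _] := tT.
have := mle_unitS le_eta => /mle_mconsP[i0 iS].
have le_eta' j : (eta j + munit i j <= nu j)%N.
  by have := forallP le_eta j; rewrite ffunE.
have E (a b : multi d.+1) k : (a + b) k = (a k + b k)%N by rewrite ffunE.
have unitSE j : unitS i (lift ord0 j) = munit i j by rewrite !ffunE (inj_eq lift_inj).
split; first (by lia); first by apply/mle_mconsP.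
- by apply/mle_mconsP; split=> [|j]; rewrite E !ffunE ?eqxx//; lia.
- apply/mle_mconsP; split=> [|j]; rewrite E; first by rewrite !ffunE eqxx.
  by rewrite [unit0 _]ffunE; exact: iS.
- move=> alpha /(typed_le tT)[a0 aS]; split; apply/mle_mconsP; split=> [|j]; rewrite E.
  + by rewrite [unit0 _]ffunE eqxx; lia.
  + by rewrite [unit0 _]ffunE addn0; have := aS j; have := le_eta' j; lia.
  + by rewrite [unitS _ _]ffunE; lia.
  + by rewrite unitSE; have := aS j; have := le_eta' j; lia.
Qed.

Lemma ext_term_value_cont eta T : eta != 0 -> mle eta nu -> typed eta T ->
  continuous (zero_ext (term_value T)).
Proof.
move=> eta0 le_eta tT; have [T1 T2] := typed_mle tT le_eta.
apply: (continuous_zero_extension open_U).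
  by move=> y Uy; exact: term_value_cont.
by move=> z Uz; apply: within_boundary => // bz; exact: (decay eta0 le_eta tT bz).
Qed.

Lemma ext_sum (r : seq (nat * seq (multi d.+1))) :
  zero_ext (fun y => \sum_(T <- r) term_value T y) = fun y => \sum_(T <- r) zero_ext (term_value T) y.
Proof. by apply/funext => y; rewrite /zero_ext; case: ifP => // _; rewrite big1. Qed.

Lemma ext_deriv_terms_cont w : w != [::] -> mle (mcount w) nu ->
  continuous (zero_ext (fun y => \sum_(T <- deriv_terms w) term_value T y)).
Proof.
move=> w0 le_w; rewrite ext_sum.
have Hc T : T \in deriv_terms w -> continuous (zero_ext (term_value T)).
  move=> /typed_deriv_terms tT; apply: ext_term_value_cont tT => //.
  apply/eqP => E; have := mdeg_mcount w; rewrite E.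
  by rewrite /mdeg big1 => [|j _]; [case: (w) w0|rewrite ffunE].
elim: (deriv_terms w) Hc => [_|T r IH Hc].
  rewrite (_ : (fun y => _) = cst 0); first exact: cst_continuous.
  by apply/funext => y; rewrite big_nil.
rewrite (_ : (fun y => _) = fun y => zero_ext (term_value T) y + \sum_(T <- r) zero_ext (term_value T) y).
  have c1 := Hc T (mem_head _ _).
  have c2 := IH (fun T' T'r => Hc T' (mem_behead (T'r : T' \in behead (T :: r)))).
  by move=> y; exact: (cvgD (c1 y) (c2 y)).
by apply/funext => y; rewrite big_cons.
Qed.

Lemma is_derive_sum_terms (r : seq (nat * seq (multi d.+1))) y i
    (D : nat * seq (multi d.+1) -> R) :
  (forall T, T \in r -> is_derive y (delta_mx ord0 i) (term_value T) (D T)) ->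
  is_derive y (delta_mx ord0 i) (fun z => \sum_(T <- r) term_value T z) (\sum_(T <- r) D T).
Proof.
elim: r => [_|T r IH Hr].
  rewrite big_nil (_ : (fun z => _) = cst 0); first exact: is_derive_cst.
  by apply/funext => z; rewrite big_nil.
rewrite (_ : (fun z => _) = term_value T + (fun z => \sum_(T <- r) term_value T z)); last first.
  by apply/funext => z; rewrite big_cons.
rewrite big_cons; apply: is_deriveD; first by apply: Hr; rewrite mem_head.
by apply: IH => T' T'r; apply: Hr; rewrite inE T'r orbT.
Qed.

(** Inside U this is the computation with terms. Across the boundary the decay
    condition makes both sums, extended by 0, continuous, and the zero extension
    stays differentiable. *)
Lemma is_derive_ext_terms w i : w != [::] -> mle (mcount (i :: w)) nu ->
  forall y, is_derive y (delta_mx ord0 i)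
    (zero_ext (fun y => \sum_(T <- deriv_terms w) term_value T y))
    (zero_ext (fun y => \sum_(T <- deriv_terms (i :: w)) term_value T y) y).
Proof.
move=> w0 le_w; apply: (is_derive_zero_extension open_U).
- by apply: ext_deriv_terms_cont w0 _; exact: mle_mcountW le_w.
- by move=> y Uy; rewrite /zero_ext memNset.
- exact: ext_deriv_terms_cont.
- by move=> y Uy; rewrite /zero_ext memNset.
move=> y Uy; rewrite {2}/zero_ext mem_set//.
apply: (@near_eq_is_derive _ _ _ (fun y => \sum_(T <- deriv_terms w) term_value T y)).
  have : nbhs y U by exact: open_nbhs_nbhs.
  by apply: filterS => z Uz; rewrite /zero_ext mem_set.
rewrite (_ : \sum_(T <- deriv_terms (i :: w)) _ =
    \sum_(T <- deriv_terms w) \sum_(T2 <- term_terms i T) term_value T2 y).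
  apply: is_derive_sum_terms => T /typed_deriv_terms tT.
  rewrite mcount_cons in le_w; have [? ? ? ? ?] := typed_mleD tT le_w.
  exact: is_derive_term_value.
case: w w0 {le_w} => // j w _; rewrite deriv_terms_cons2.
by rewrite big_flatten big_map.
Qed.

End TermValues.

(** * Distribution functions *)

Section CumulativeDistribution.
Context {R : realType}.
Variable rho0 : R -> R.
Hypothesis rho0_density : is_density rho0.
Notation mu := (@lebesgue_measure R).

Lemma density_integrable : mu.-integrable setT (EFin \o rho0).
Proof.
have [mr r0 r1 _] := rho0_density.
apply/integrableP; split; first exact/measurable_EFinP.
under eq_integral do rewrite /= ger0_norm//.
by rewrite r1 ltry.
Qed.

Lemma density_integrableS (A : set R) : measurable A -> mu.-integrable A (EFin \o rho0).
Proof. by move=> mA; apply: integrableS density_integrable. Qed.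

Lemma cdf_ofE z : (cdf_of rho0 z)%:E = (\int[mu]_(x in `]-oo, z]) (rho0 x)%:E)%E.
Proof.
by rewrite /cdf_of /Rintegral fineK//; apply: integrable_fin_num => //; exact: density_integrableS.
Qed.

Lemma cdf_of_ge0 z : 0 <= cdf_of rho0 z.
Proof. by apply: Rintegral_ge0 => x _; have [_ + _ _] := rho0_density; exact. Qed.

Lemma cdf_of_le x y : x <= y -> cdf_of rho0 x <= cdf_of rho0 y.
Proof.
move=> xy; have [mr r0 _ _] := rho0_density.
rewrite -lee_fin !cdf_ofE; apply: ge0_subset_integral => //.
- by apply: measurable_funTS; exact/measurable_EFinP.
- by move=> z _; rewrite lee_fin.
- by apply: subset_itvl; rewrite bnd_simp.
Qed.

Lemma cdf_of_le1 z : cdf_of rho0 z <= 1.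
Proof.
have [mr r0 r1 _] := rho0_density.
rewrite -lee_fin cdf_ofE -r1; apply: ge0_subset_integral => //.
- exact/measurable_EFinP.
- by move=> x _; rewrite lee_fin.
Qed.

(** Dominated convergence; the truncated densities are eventually 0 at each point. *)
Lemma cdf_of_Ny e : 0 < e -> exists M, cdf_of rho0 M <= e.
Proof.
move=> e0; have [mr r0 r1 _] := rho0_density.
pose f_ (k : nat) := (EFin \o rho0) \_ `]-oo, (- k%:R : R)]%classic.
have [|||//||_ _] := @dominated_convergence _ _ R mu setT measurableT f_ (cst 0%E) (EFin \o rho0).
- move=> k; apply/(measurable_restrictT _ _).1 => //.
  by apply: measurable_funTS; exact/measurable_EFinP.
- exact: measurable_cst.
- apply: aeW => x _; apply: cvg_near_cst; exists (Num.bound x) => // k /= xk.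
  rewrite /f_ patchE ifN//; apply/negP; rewrite inE /= in_itv/= lerNr => kx.
  have := archi_boundP (normr_ge0 x); rewrite /Num.bound normr_id ltNge => /negP; apply.
  rewrite (@le_trans _ _ k%:R)//; first by rewrite ler_nat.
  by rewrite (le_trans kx)// -normrN ler_norm.
- exact: density_integrable.
- apply: aeW => x k _; rewrite /f_ patchE; case: ifP => _ /=.
    by rewrite ger0_norm.
  by rewrite normr0 lee_fin.
rewrite integral0 => /fine_cvgP[_ /cvgrPdist_le/(_ _ e0)[k _ Hk]].
exists (- k%:R); have := Hk k (leqnn k).
rewrite /= /f_ -integral_mkcond -cdf_ofE /= sub0r normrN ger0_norm//.
exact: cdf_of_ge0.
Qed.

Lemma is_derive_cdf_of (z : R) : continuous rho0 -> is_derive z (1 : R) (cdf_of rho0) (rho0 z).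
Proof.
move=> cr; have zz1 : z < z + 1 by rewrite ltrDl.
have [//||//|d1 d2] := @continuous_FTC1 R rho0 (BInfty _ true) z (z + 1) zz1.
- exact: density_integrableS.
- exact: ltNyr.
- exact: cr.
- by split; [exact: d1|rewrite -derive1E; exact: d2].
Qed.

End CumulativeDistribution.

(** * Regularity of the preintegrated indicator function *)

Section Preintegrated.
Context {R : realType} {d : nat}.
Variables (rho : 'I_d.+1 -> R -> R) (phi : 'rV[R]_d.+1 -> R) (t : R) (nu : multi d).
Local Notation nu' := (mcons (mdeg nu).+1 nu).
Hypothesis phi_Cmulti : Cmulti nu' phi.
Hypothesis D0_gt0 : forall x, 0 < partial ord0 phi x.
Hypothesis phi_lim : forall y, phi (pcons y0 y) @[y0 --> +oo] --> +oo.
Hypothesis rho0_Ck : Ck (mdeg nu) (rho ord0).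
Hypothesis rho0_density : is_density (rho ord0).
Implicit Types (y z : 'rV[R]_d) (i : 'I_d) (eta : multi d).
Local Notation U := (Ut phi t).
Local Notation xi := (xi phi t).
Local Notation g := (P0 rho (gfun phi t)).
Local Notation rho0 := (rho ord0).

Let c_phi := phi_continuous phi_Cmulti.
Let d_phi := phi_derivable phi_Cmulti (mle_unit0 nu).
Let open_U : open U.
Proof. exact: (open_Ut c_phi d_phi D0_gt0). Qed.
Let rho0_cont : continuous rho0.
Proof. exact: (rho0_Ck.2 0%N). Qed.

Lemma P0_in y : U y -> g y = cdf_of rho0 (xi y).
Proof.
move=> Uy; rewrite /P0 /cdf_of [RHS]Rintegral_mkcond; apply: eq_Rintegral => r _.
rewrite patchE /gfun /ind subr_ge0; case: ifPn => H.
  rewrite mul1r ifT// inE /= in_itv/= leNgt; apply/negP => /(phi_pcons_lt d_phi D0_gt0 y).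
  by rewrite (xiP Uy) ltNge H.
rewrite mul0r ifN//; apply/negP; rewrite inE /= in_itv/= => rxi.
move/negP : H; apply; rewrite -[leRHS](xiP Uy); move: rxi; rewrite le_eqVlt => /orP[/eqP->//|].
by move/(phi_pcons_lt d_phi D0_gt0 y)/ltW.
Qed.

Lemma P0_out y : ~ U y -> g y = 0.
Proof.
move=> Uy; rewrite /P0 (_ : (fun r => _) = cst 0).
  by rewrite /Rintegral integral0.
apply/funext => r; rewrite /gfun /ind subr_ge0 leNgt.
by rewrite (notin_Ut c_phi d_phi D0_gt0 phi_lim r Uy) mul0r.
Qed.

Lemma P0E : g = zero_ext phi t (cdf_of rho0 \o xi).
Proof.
apply/funext => y; rewrite /zero_ext; case: ifPn => Uy.
  by rewrite P0_in//; rewrite inE in Uy.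
by rewrite P0_out// => /mem_set; apply/negP.
Qed.

Lemma P0_01 y : 0 <= g y <= 1.
Proof.
rewrite P0E /zero_ext; case: ifP => _; last by rewrite lexx ler01.
by rewrite /= cdf_of_ge0// cdf_of_le1.
Qed.

(** Near a point z outside U the inequality phi > t at (M, z) persists, so xi stays
    below M; as M is arbitrary, Phi_0 (xi y) tends to Phi_0 (-oo) = 0. *)
Lemma P0_cont : continuous g.
Proof.
have ccdf : continuous (cdf_of rho0).
  move=> z; apply/differentiable_continuous/derivable1_diffP.
  by case: (is_derive_cdf_of rho0_density z rho0_cont).
rewrite P0E; apply: (continuous_zero_extension open_U).
  move=> y Uy; apply: continuous_at_comp; last exact: ccdf.
  exact: (xi_cont c_phi d_phi D0_gt0 Uy).
move=> z Uz; apply/cvgrPdist_le => e e0.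
have [M Me] := cdf_of_Ny rho0_density e0.
have c : (fun z => phi (pcons M z)) @ z --> phi (pcons M z).
  exact: (continuous_comp (@continuous_pcons R d M z) (@c_phi _)).
have : \forall y \near z, t < phi (pcons M y).
  apply: (cvgr_gt _ c); exact: (notin_Ut c_phi d_phi D0_gt0 phi_lim M Uz).
rewrite near_withinE; apply: filterS => y yM Uy.
rewrite sub0r normrN ger0_norm ?cdf_of_ge0//= (le_trans _ Me)//.
by apply: cdf_of_le => //; apply: ltW; exact: (xi_lt d_phi D0_gt0 Uy yM).
Qed.

Hypothesis decay : forall eta, eta != 0 -> mle eta nu -> forall T, typed eta T ->
  forall z, boundary U z -> term_value phi t rho0 T @ within U (nbhs z) --> (0 : R).

Local Notation Dw w := (zero_ext phi t (fun y => \sum_(T <- deriv_terms w) term_value phi t rho0 T y)).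

Lemma is_derive_P0 i y : mle (mcount [:: i]) nu -> is_derive y (delta_mx ord0 i) g (Dw [:: i] y).
Proof.
move=> le_i; move: y; apply: (is_derive_zero_extension open_U).
- exact: P0_cont.
- by move=> y Uy; rewrite P0_out.
- exact: (ext_deriv_terms_cont phi_Cmulti D0_gt0 rho0_Ck decay).
- by move=> y Uy; rewrite /zero_ext memNset.
move=> y Uy; rewrite /zero_ext mem_set// /= big_seq1 /term_value /= big_seq1.
apply: (@near_eq_is_derive _ _ _ (cdf_of rho0 \o xi)).
  have : nbhs y U by exact: open_nbhs_nbhs.
  by apply: filterS => z Uz; rewrite P0_in.
have le_i' : mle (unitS i) nu'.
  by apply: (@mle_unitS _ nu 0); rewrite add0r; move: le_i; rewrite mcount_cons (_ : mcount [::] = 0) ?add0r//; apply/ffunP => k; rewrite !ffunE.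
have cphi : continuous (partial (lift ord0 i) phi).
  by rewrite -mderiv_unit; exact: (mderiv_cont phi_Cmulti).
have dxi := is_derive_xi c_phi d_phi D0_gt0 (D0_continuous phi_Cmulti) Uy
  (phi_derivable phi_Cmulti le_i') cphi.
apply: is_derive_of_line.
have dl : is_derive (0 : R) (1 : R) (fun r : R => xi (r *: delta_mx ord0 i + y)) (level_ratio phi t (unitS i) y).
  apply: (@is_derive_line R _ xi y (delta_mx ord0 i)); rewrite scale0r add0r.
  by rewrite /level_ratio mderiv_unit.
have E0 : xi y = xi (0 *: delta_mx ord0 i + y) by rewrite scale0r add0r.
by rewrite E0; exact: (is_derive1_comp (is_derive_cdf_of rho0_density _ rho0_cont) dl).
Qed.

(** The first differentiation starts from Phi_0 (xi y), the later ones from sums of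
    terms; the zero extension argument is repeated at each of them. *)
Lemma iter_partial_P0 w : mle (mcount w) nu ->
  ex_iter_partial w g /\ iter_partial w g = if w is [::] then g else Dw w.
Proof.
elim: w => [//|i w IH] le_w; have [exw Ew] := IH (mle_mcountW le_w).
have H y : is_derive y (delta_mx ord0 i) (iter_partial w g) (Dw (i :: w) y).
  rewrite Ew; case: w le_w {IH exw Ew} => [|j w] le_w; first exact: is_derive_P0.
  exact: (is_derive_ext_terms phi_Cmulti D0_gt0 rho0_Ck decay).
split; first by split => // y; case: (H y).
by apply/funext => y; case: (H y).
Qed.

Lemma mderiv_P0 eta : eta != 0 -> mle eta nu -> mderiv eta g = Dw (mseq eta).
Proof.
move=> eta0 le_eta.
have [|_] := @iter_partial_P0 (mseq eta); first by rewrite mcount_mseq.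
rewrite /mderiv => ->; case E : (mseq eta) => //.
move/eqP: eta0; case; rewrite -(mcount_mseq eta) E.
by apply/ffunP => j; rewrite !ffunE.
Qed.

Lemma P0_Cmulti : Cmulti nu g.
Proof.
move=> eta le_eta.
have [|ex_eta _] := @iter_partial_P0 (mseq eta); first by rewrite mcount_mseq.
split => //; have [->|eta0] := eqVneq eta 0; first by rewrite mderiv0; exact: P0_cont.
rewrite mderiv_P0//; apply: (ext_deriv_terms_cont phi_Cmulti D0_gt0 rho0_Ck decay).
  by apply: contra eta0 => /eqP E; rewrite -(mcount_mseq eta) E; apply/eqP/ffunP => j; rewrite !ffunE.
by rewrite mcount_mseq.
Qed.

End Preintegrated.

(** * Weights, and terms as functions of type (0, eta) *)

Section Weights.
Context {R : realType}.
Notation mu := (@lebesgue_measure R).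

Lemma measurable_weight n (psi rho : 'I_n -> R -> R) eta :
  (forall i, measurable_fun setT (psi i)) -> (forall i, measurable_fun setT (rho i)) ->
  measurable_fun setT (weight psi rho eta).
Proof.
move=> mpsi mrho; apply: measurable_funM.
- under eq_fun do rewrite -big_filter.
  apply: measurable_prod => i _.
  by apply: measurableT_comp => //; exact: measurable_coord.
- under eq_fun do rewrite -big_filter.
  apply: measurable_prod => i _.
  by apply: measurableT_comp => //; exact: measurable_coord.
Qed.

Lemma weight_ge0 n (psi rho : 'I_n -> R -> R) eta y :
  (forall i z, 0 <= psi i z) -> (forall i z, 0 <= rho i z) -> 0 <= weight psi rho eta y.
Proof. by move=> psi0 rho0; rewrite /weight mulr_ge0//; apply: prodr_ge0. Qed.

Lemma weight0 n (psi rho : 'I_n -> R -> R) y : weight psi rho 0 y = \prod_i rho i (y ord0 i).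
Proof.
rewrite /weight big_pred0 ?mul1r => [|i]; last by rewrite ffunE.
by apply: eq_bigl => i; rewrite ffunE.
Qed.

(** Fubini's theorem, one density at a time. This makes the contribution of
    eta = 0 to the norm at most 1. *)
Lemma integral_prod_density n (rho : 'I_n -> R -> R) : (forall i, is_density (rho i)) ->
  (\int[lebesgue_rV R n]_y (\prod_i rho i (y ord0 i))%:E = 1)%E.
Proof.
elim: n rho => [|n IH] rho Hrho.
  under eq_integral do rewrite big_ord0.
  by rewrite /= integral_cst// mul1e; exact: diracT.
have mp k (r : 'I_k -> R -> R) : (forall i, is_density (r i)) ->
    measurable_fun setT (fun y : 'rV[R]_k => (\prod_i r i (y ord0 i))%:E).
  move=> Hr; apply/measurable_EFinP; apply: measurable_prod => i _.
  apply: measurableT_comp; [by case: (Hr i)|exact: measurable_coord].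
have p0 k (r : 'I_k -> R -> R) (y : 'rV[R]_k) : (forall i, is_density (r i)) ->
    0 <= \prod_i r i (y ord0 i).
  by move=> Hr; apply: prodr_ge0 => i _; case: (Hr i) => _ + _ _; exact.
have HS i : is_density (rho (lift ord0 i)) by [].
rewrite ge0_integral_pcons; last 2 first.
- exact: mp.
- by move=> x; rewrite lee_fin; exact: p0.
have [m0 r0 r1 _] := Hrho ord0.
rewrite -[RHS]r1; apply: eq_integral => y0 _.
transitivity (\int[lebesgue_rV R n]_y ((rho ord0 y0)%:E *
    (\prod_i rho (lift ord0 i) (y ord0 i))%:E))%E.
  apply: eq_integral => y _; rewrite -EFinM; congr EFin.
  rewrite big_ord_recl pcons0; congr (_ * _); apply: eq_bigr => i _.
  by rewrite pconsS.
rewrite ge0_integralZl_EFin//.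
- by rewrite (IH (fun i => rho (lift ord0 i)))// mule1.
- by move=> y _; rewrite lee_fin; exact: (p0 _ (fun i => rho (lift ord0 i))).
- exact: (mp _ (fun i => rho (lift ord0 i))).
Qed.

(** The Cauchy-Schwarz inequality against the constant vector. With N terms of
    squared norm at most B it gives N^2 B, the source of the squared count in the
    final bound. *)
Lemma sqr_sum_le (I : Type) (r : seq I) (F : I -> R) :
  (\sum_(i <- r) F i) ^+ 2 <= (size r)%:R * \sum_(i <- r) F i ^+ 2.
Proof.
elim: r => [|i r IH]; first by rewrite !big_nil expr0n mulr0.
rewrite !big_cons /=; set S := \sum_(j <- r) F j in IH *; set Q := \sum_(j <- r) _ in IH *.
have Q0 : 0 <= Q by apply: sumr_ge0 => j _; exact: sqr_ge0.
have [r0|r0] := posnP (size r).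
  have -> : S = 0 by rewrite /S; case: (r) r0 => // _; rewrite big_nil.
  by rewrite r0 addr0 mul1r lerDl.
have n0 : 0 < (size r)%:R :> R by rewrite ltr0n.
rewrite -natr1; move: IH n0; move: (size r)%:R (F i) => m a IH m0.
have H : 0 <= m * (m * a ^+ 2 + Q - 2 * a * S).
  have -> : m * (m * a ^+ 2 + Q - 2 * a * S) = (m * a - S) ^+ 2 + (m * Q - S ^+ 2) by ring.
  by rewrite addr_ge0 ?sqr_ge0// subr_ge0.
rewrite pmulr_rge0// in H.
have -> : (m + 1) * (a ^+ 2 + Q) =
    (a + S) ^+ 2 + ((m * a ^+ 2 + Q - 2 * a * S) + (m * Q - S ^+ 2)) by ring.
by rewrite lerDl addr_ge0// subr_ge0.
Qed.

End Weights.

(** At least one term occurs, so that some integral is bounded by the decay constant;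
    this is what shows that the constant is nonnegative. *)
Lemma deriv_terms_gt0 d (w : seq 'I_d) : w != [::] -> (0 < size (deriv_terms w))%N.
Proof.
elim: w => // i [//|j w] IH _; rewrite deriv_terms_cons2.
by case: (deriv_terms (j :: w)) (IH isT) => // T r _; rewrite /= size_cat.
Qed.

Lemma mulrn_ffunE n (f : multi n) k j : (f *+ k) j = (f j * k)%N.
Proof. by elim: k => [|k IH]; rewrite ?mulr0n ?ffunE ?muln0// mulrS ffunE IH mulnS. Qed.

Section TypedFunctions.
Variable d : nat.
Implicit Types (T : nat * seq (multi d.+1)) (eta : multi d).

Definition term_alpha T : 'I_(size T.2) -> multi d.+1 := fun l => nth 0 T.2 l.

Lemma typed_type_params eta T : typed eta T -> type_params 0 eta T.1 (term_alpha (T := T)).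
Proof.
case: T => beta s [H1 H2 H3 H4 [H5 H6]]; split; rewrite /= ?addn0//.
- by move=> l; have [] := H1 _ (mem_nth 0 (ltn_ord l)).
- by move=> l; have [] := H1 _ (mem_nth 0 (ltn_ord l)).
split => //; apply/ffunP => k.
have E : (\sum_l term_alpha (T := (beta, s)) l) = \sum_(alpha <- s) alpha.
  by rewrite (big_nth 0) big_mkord.
rewrite E ffunE mulrn_ffunE sum_ffunE /= [RHS]ffunE.
case: unliftP => [j ->|->] /=; rewrite ffunE /=.
  by rewrite -H6 mul0n add0r.
by rewrite mul1n -H5.
Qed.

(** For q = 0 the numerator has as many factors D^alpha phi as there are powers of
    D^0 phi and signs, so that these can be distributed to form the ratios m_alpha. *)
Lemma hfun_term_value (R : realType) (rho : 'I_d.+1 -> R -> R) (phi : 'rV[R]_d.+1 -> R) T t y :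
  hfun rho phi 0 T.1 (term_alpha (T := T)) t y = term_value phi t (rho ord0) T y.
Proof.
rewrite /hfun /term_value /term_alpha addn0.
rewrite -(big_mkord xpredT (fun l => mderiv (nth 0 T.2 l) phi (pcons (xi phi t y) y))).
rewrite -(big_nth 0 xpredT (fun alpha => mderiv alpha phi (pcons (xi phi t y) y))).
rewrite [(-1) ^+ _ * _]mulrC -!mulrA; congr (_ * _).
rewrite /level_ratio /graph; set C := partial _ _ _.
elim: T.2 => [|alpha s IH]; first by rewrite !big_nil expr0 mul1r expr0 invr1 mulr1.
by rewrite !big_cons -IH /= !exprS invfM; ring.
Qed.

End TypedFunctions.

(** * The norm bound *)

Section NormBound.
Context {R : realType} {d : nat}.
Variables (nu : multi d) (rho psi : 'I_d.+1 -> R -> R) (gamma : {set 'I_d.+1} -> R).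
Variables (phi : 'rV[R]_d.+1 -> R) (B : multi d -> R) (t : R).
Implicit Types eta : multi d.
Hypothesis rho_density : forall i, is_density (rho i).
Hypothesis psi_gt0 : forall i z, 0 < psi i z.
Hypothesis psi_measurable : forall i, measurable_fun setT (psi i).
Hypothesis gamma_gt0 : forall u, 0 < gamma u.
Hypothesis gamma_set0 : gamma finset.set0 = 1.
Hypothesis phi_Cmulti : Cmulti (mcons (mdeg nu).+1 nu) phi.
Hypothesis D0_gt0 : forall x, 0 < partial ord0 phi x.
Hypothesis phi_lim : forall y, phi (pcons y0 y) @[y0 --> +oo] --> +oo.
Hypothesis rho0_Ck : Ck (mdeg nu) (rho ord0).
Local Notation U := (Ut phi t).
Local Notation g := (P0 rho (gfun phi t)).
Local Notation val T := (term_value phi t (rho ord0) T).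
Local Notation wt eta := (weight (psiS psi) (rhoS rho) eta).
Local Notation mun := (lebesgue_rV R d).
Hypothesis decay : forall eta, eta != 0 -> mle eta nu -> forall T, typed eta T ->
  forall z, boundary U z -> val T @ within U (nbhs z) --> (0 : R).
Hypothesis val_le : forall eta, eta != 0 -> mle eta nu -> forall T, typed eta T ->
  (\int[mun]_(y in U) (`|val T y| ^+ 2 * wt eta y)%:E <= (B eta)%:E)%E.

Let Cg : Cmulti nu g.
Proof. exact: (P0_Cmulti phi_Cmulti D0_gt0 phi_lim rho0_Ck (rho_density ord0) decay). Qed.

Let measurable_wt eta : measurable_fun setT (wt eta).
Proof.
by apply: measurable_weight => i; [exact: psi_measurable|case: (rho_density (lift ord0 i))].
Qed.

Let wt_ge0 eta y : 0 <= wt eta y.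
Proof.
apply: weight_ge0 => i z; first by rewrite ltW// psi_gt0.
by case: (rho_density (lift ord0 i)) => _ + _ _; exact.
Qed.

Let measurable_sqr_wt (f : 'rV[R]_d -> R) eta : measurable_fun setT f ->
  measurable_fun setT (fun y : 'rV[R]_d => (`|f y| ^+ 2 * wt eta y)%:E).
Proof.
move=> mf; apply/measurable_EFinP; apply: measurable_funM => //.
by apply: measurable_funX; exact: measurableT_comp.
Qed.

Let sqr_wt_ge0 (f : 'rV[R]_d -> R) eta y : (0 <= (`|f y| ^+ 2 * wt eta y)%:E)%E.
Proof. by rewrite lee_fin mulr_ge0// sqr_ge0. Qed.

Lemma deriv_terms_mseq_gt0 eta : eta != 0 -> (0 < size (deriv_terms (mseq eta)))%N.
Proof.
move=> eta0; apply: deriv_terms_gt0; apply: contra eta0 => /eqP E.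
by rewrite -(mcount_mseq eta) E; apply/eqP/ffunP => j; rewrite !ffunE.
Qed.

(** The derivative is a sum of at most N functions of type (0, eta), extended by 0,
    each of squared norm at most B, and Cauchy-Schwarz gives N^2 B. *)
Lemma integral_mderiv_P0_le eta : eta != 0 -> mle eta nu ->
  (\int[mun]_y (`|mderiv eta g y| ^+ 2 * wt eta y)%:E <=
   ((8 ^ (mdeg eta).-1 * ((mdeg eta).-1)`!)%N%:R ^+ 2 * B eta)%:E)%E.
Proof.
move=> eta0 le_eta; set N := (_ * _)%N.
rewrite (mderiv_P0 phi_Cmulti D0_gt0 phi_lim rho0_Ck (rho_density ord0) decay eta0 le_eta).
set r := deriv_terms (mseq eta); rewrite ext_sum.
have rN : (size r <= N)%N.
  by have := size_deriv_terms (mseq eta); rewrite -mdeg_mcount mcount_mseq.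
have tr (l : 'I_(size r)) : typed eta (tnth (in_tuple r) l).
  have : tnth (in_tuple r) l \in r by exact: mem_tnth.
  by move/typed_deriv_terms; rewrite mcount_mseq.
pose F (l : 'I_(size r)) := zero_ext phi t (val (tnth (in_tuple r) l)).
have cF l : continuous (F l) by exact: (ext_term_value_cont phi_Cmulti D0_gt0 rho0_Ck decay eta0).
have FB l : (\int[mun]_y (`|F l y| ^+ 2 * wt eta y)%:E <= (B eta)%:E)%E.
  apply: le_trans (val_le eta0 le_eta (tr l)).
  rewrite [leRHS]integral_mkcond; rewrite le_eqVlt; apply/orP; left; apply/eqP; apply: eq_integral => y _.
  rewrite patchE /F /zero_ext; case: ifPn => // _.
  by rewrite normr0 expr0n mul0r.
have B0 : 0 <= B eta.
  rewrite -lee_fin; apply: le_trans (FB (Ordinal (deriv_terms_mseq_gt0 eta0))).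
  by apply: integral_ge0 => y _; exact: sqr_wt_ge0.
apply: (@le_trans _ _ (\int[mun]_y (\sum_(l < size r)
    (size r)%:R%:E * (`|F l y| ^+ 2 * wt eta y)%:E))%E).
  apply: ge0_le_integral => //.
  - by move=> y _; rewrite lee_fin mulr_ge0 ?wt_ge0 ?exprn_ge0.
  - apply: measurable_sqr_wt; apply: continuous_measurable_rV.
    rewrite (_ : (fun y => _) = zero_ext phi t (fun y => \sum_(T <- r) val T y)); last by rewrite ext_sum.
    apply: (ext_deriv_terms_cont phi_Cmulti D0_gt0 rho0_Ck decay); last by rewrite mcount_mseq.
    by have := deriv_terms_mseq_gt0 eta0; case: (mseq eta).
  - apply: emeasurable_sum => l; apply: emeasurable_funM; first exact: measurable_cst.
    by apply: measurable_sqr_wt; exact: continuous_measurable_rV.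
  - move=> y _; under [X in (_ <= X)%E]eq_bigr do rewrite -EFinM.
    rewrite sumEFin lee_fin (big_tnth _ _ r) -mulr_sumr -mulr_suml mulrA ler_wpM2r//.
    rewrite real_normK ?num_real//.
    apply: le_trans (sqr_sum_le _ _) _.
    have -> : size (index_enum 'I_(size r)) = size r.
      by rewrite -[RHS]size_enum_ord enumT; unlock index_enum.
    by under [X in _ <= _ * X]eq_bigr do rewrite real_normK ?num_real//.
rewrite ge0_integral_sum//; last 2 first.
- move=> l; apply: emeasurable_funM; first exact: measurable_cst.
  by apply: measurable_sqr_wt; exact: continuous_measurable_rV.
- by move=> l y _; rewrite mule_ge0// lee_fin.
apply: (@le_trans _ _ (\sum_(l < size r) ((size r)%:R * B eta)%:E)%E).
  apply: lee_sum => l _; rewrite ge0_integralZl_EFin//.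
  - by rewrite EFinM lee_wpmul2l ?lee_fin.
  - by apply: measurable_sqr_wt; exact: continuous_measurable_rV.
rewrite sumEFin lee_fin sumr_const card_ord -[leLHS]mulr_natl mulrA -expr2 ler_wpM2r//.
by rewrite lerXn2r ?nnegrE ?ler0n// ler_nat.
Qed.

Lemma integral_weak_deriv_P0 eta : mle eta nu ->
  (\int[mun]_y (`|weak_deriv eta g y| ^+ 2 * wt eta y)%:E =
   \int[mun]_y (`|mderiv eta g y| ^+ 2 * wt eta y)%:E)%E.
Proof.
move=> le_eta; have [[[mw _] _] ae] := weak_deriv_mderiv Cg le_eta.
apply: ge0_ae_eq_integral => //.
- exact: measurable_sqr_wt.
- by apply: measurable_sqr_wt; apply: continuous_measurable_rV; exact: (Cg le_eta).2.
- by apply: filterS ae => y -> _.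
Qed.

Lemma integral_sqr_P0_le1 : (\int[mun]_y (`|mderiv 0 g y| ^+ 2 * wt 0 y)%:E <= 1)%E.
Proof.
rewrite mderiv0 -(integral_prod_density (rho := rhoS rho)); last by move=> i; exact: rho_density.
have mg : measurable_fun setT g.
  by apply: continuous_measurable_rV; exact: (P0_cont phi_Cmulti D0_gt0 phi_lim rho0_Ck (rho_density ord0)).
have E y : wt 0 y = \prod_i rhoS rho i (y ord0 i) by exact: weight0.
apply: ge0_le_integral => //.
- exact: measurable_sqr_wt.
- by apply/measurable_EFinP; apply: (eq_measurable_fun (wt 0)).
- move=> y _; rewrite lee_fin -E -[leRHS]mul1r ler_wpM2r//.
  have /andP[g0 g1] : 0 <= g y <= 1 by exact: (P0_01 t phi_Cmulti D0_gt0 phi_lim (rho_density ord0)).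
  by rewrite ger0_norm// exprn_ile1.
Qed.

Lemma mbelow_le (eta : mbelow nu) : mle eta nu.
Proof. by apply/forallP => i; rewrite ffunE -ltnS. Qed.

Lemma mbelow_onto eta : mle eta nu -> exists e : mbelow nu, mbelow_val e = eta.
Proof.
move=> /forallP le_eta.
have H i : (eta i < (nu i).+1)%N by rewrite ltnS.
by exists [ffun i => Ordinal (H i)]; apply/ffunP => i; rewrite !ffunE.
Qed.

Lemma mbelow_val_inj : injective (@mbelow_val d nu).
Proof.
move=> e1 e2 /ffunP E; apply/ffunP => i; apply: val_inj.
by have := E i; rewrite !ffunE.
Qed.

Lemma msupp0 : msupp (0 : multi d) = finset.set0.
Proof. by apply/setP => i; rewrite !inE ffunE. Qed.

Lemma Hnorm_sq_P0_le :
  (Hnorm_sq (gammaS gamma) (psiS psi) (rhoS rho) nu g <=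
   (1 + \sum_(eta : mbelow nu | mbelow_val eta != 0)
     ((8 ^ (mdeg eta).-1 * ((mdeg eta).-1)`!)%N%:R ^+ 2 * B eta
                 / gammaS gamma (msupp eta)))%:E)%E.
Proof.
have le0 : mle 0 nu by apply/forallP => i; rewrite ffunE.
have [z z0] := mbelow_onto le0.
rewrite /Hnorm_sq (bigD1 z)//= EFinD -sumEFin; apply: leeD.
  rewrite z0 /gammaS msupp0 imset0 gamma_set0 invr1 mul1e.
  by rewrite integral_weak_deriv_P0//; exact: integral_sqr_P0_le1.
have Pz (eta : mbelow nu) : (eta != z) = (mbelow_val eta != 0).
  by rewrite -z0 (inj_eq mbelow_val_inj).
rewrite (eq_bigl _ _ Pz); apply: lee_sum => eta eta0.
have g0 : 0 < gammaS gamma (msupp eta) by exact: gamma_gt0.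
rewrite integral_weak_deriv_P0 ?mbelow_le// mulrC EFinM lee_wpmul2l//.
  by rewrite lee_fin invr_ge0 ltW.
exact: (integral_mderiv_P0_le eta0 (mbelow_le eta)).
Qed.

Lemma Hnorm_P0_le :
  (Hnorm (gammaS gamma) (psiS psi) (rhoS rho) nu g <=
   (Num.sqrt (1 + \sum_(eta : mbelow nu | mbelow_val eta != 0)
     ((8 ^ (mdeg eta).-1 * ((mdeg eta).-1)`!)%N%:R ^+ 2 * B eta
                 / gammaS gamma (msupp eta))))%:E)%E.
Proof.
have H := Hnorm_sq_P0_le; rewrite /Hnorm.
have H0 : (0 <= Hnorm_sq (gammaS gamma) (psiS psi) (rhoS rho) nu g)%E.
  apply: sume_ge0 => eta _; apply: mule_ge0.
    by rewrite lee_fin invr_ge0 ltW// gamma_gt0.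
  by apply: integral_ge0 => y _; exact: sqr_wt_ge0.
rewrite -[leRHS]/(sqrte (_%:E)) lee_sqrt//; exact: le_trans H0 H.
Qed.

Lemma P0_in_H : in_H (gammaS gamma) (psiS psi) (rhoS rho) nu g.
Proof.
split.
- apply: loc_integrable_continuous.
  exact: (P0_cont phi_Cmulti D0_gt0 phi_lim rho0_Ck (rho_density ord0)).
- by move=> eta le_eta; exists (mderiv eta g); exact: is_weak_deriv_mderiv Cg le_eta.
- by apply: le_lt_trans Hnorm_P0_le _; rewrite ltry.
Qed.

End NormBound.

Theorem theorem3p2 (R : realType) (d : nat) (nu : multi d) (a b : R)
    (rho psi : 'I_d.+1 -> R -> R) (gamma : {set 'I_d.+1} -> R)
    (phi : 'rV[R]_d.+1 -> R) (B : multi d -> R)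
    (d_gt0 : (0 < d)%N)
    (ab : a <= b)
    (rho_density : forall i, is_density (rho i))
    (psi_gt0 : forall i z, 0 < psi i z)
    (psi_integrable : forall i,
      (@lebesgue_measure R).-integrable setT (EFin \o psi i))
    (rho_psi : forall i : 'I_d,
      (\int[@lebesgue_measure R]_z
         (cdf_of (rhoS rho i) z * (1 - cdf_of (rhoS rho i) z) /
          psiS psi i z)%:E < +oo)%E)
    (gamma_gt0 : forall u, 0 < gamma u)
    (gamma_set0 : gamma finset.set0 = 1)
    (phi_admissible : admissible gamma psi rho phi nu)
    (decay : forall eta : multi d, eta != 0 -> mle eta nu ->
      decay_condition psi rho phi a b 0 eta (B eta)) :
  (forall t, t \in `[a, b] ->
     in_H (gammaS gamma) (psiS psi) (rhoS rho) nu (P0 rho (gfun phi t)) /\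
     Cmulti nu (P0 rho (gfun phi t))) /\
  (ereal_sup [set Hnorm (gammaS gamma) (psiS psi) (rhoS rho) nu
                    (P0 rho (gfun phi t)) | t in `[a, b]]
   <= (Num.sqrt
         (1 + \sum_(eta : mbelow nu | mbelow_val eta != 0)
                ((8 ^ (mdeg eta).-1 * ((mdeg eta).-1)`!)%N%:R ^+ 2 * B eta
                 / gammaS gamma (msupp eta))))%:E
   < +oo)%E.
Proof.
have [D0_gt0 phi_lim [_ phi_Cmulti] rho0_Ck] := phi_admissible.
have mpsi i : measurable_fun setT (psi i).
  by apply/measurable_EFinP; exact: measurable_int (psi_integrable i).
have dec t : t \in `[a, b] -> forall eta, eta != 0 -> mle eta nu -> forall T, typed eta T ->
    forall z, boundary (Ut phi t) z ->
    term_value phi t (rho ord0) T @ within (Ut phi t) (nbhs z) --> (0 : R).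
  move=> tab eta eta0 le_eta T tT z bz.
  have [H _] := decay eta eta0 le_eta _ _ _ (typed_type_params tT).
  have := H t tab z bz.
  rewrite (_ : hfun _ _ _ _ _ _ = term_value phi t (rho ord0) T)//.
  by apply/funext => y; exact: hfun_term_value.
have vle t : t \in `[a, b] -> forall eta, eta != 0 -> mle eta nu -> forall T, typed eta T ->
    (\int[lebesgue_rV R d]_(y in Ut phi t)
      (`|term_value phi t (rho ord0) T y| ^+ 2 * weight (psiS psi) (rhoS rho) eta y)%:E
      <= (B eta)%:E)%E.
  move=> tab eta eta0 le_eta T tT.
  have [_ H] := decay eta eta0 le_eta _ _ _ (typed_type_params tT).
  apply: le_trans H; apply: ereal_sup_ubound; exists t => //.
  by apply: eq_integral => y _; rewrite hfun_term_value.
split=> [t tab|].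
  split.
    exact: (P0_in_H rho_density psi_gt0 mpsi gamma_gt0 gamma_set0 phi_Cmulti
      D0_gt0 phi_lim rho0_Ck (dec t tab) (vle t tab)).
  exact: (P0_Cmulti phi_Cmulti D0_gt0 phi_lim rho0_Ck (rho_density ord0) (dec t tab)).
apply/andP; split; last by rewrite ltry.
apply: ge_ereal_sup => _ [t tab <-].
exact: (Hnorm_P0_le rho_density psi_gt0 mpsi gamma_gt0 gamma_set0 phi_Cmulti
  D0_gt0 phi_lim rho0_Ck (dec t tab) (vle t tab)).
Qed.
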